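(* Let $a\in\mathbb{R}\setminus\{0\}$, $b>0$, $n\in\mathbb{N}$, $\alpha\geq 0$ with $n>\alpha+1$, and assume that $f\in C_\alpha^n([b,\infty))$ and the sequence $(f_m)_m$ in $C_\alpha^n([b,\infty))$ are such that $$\lim_{m\to\infty}\Vert f-f_m\Vert_{C^n_\alpha([b,\infty))}=0.$$ Then also the oscillatory integrals $\mathcal{I}_{a,b}(f_m)$ converge and one has $$\mathcal{I}_{a,b}(f)=\mathcal{I}_{a,b}\Big(\lim_{m\to\infty}f_m\Big)=\lim_{m\to\infty}\mathcal{I}_{a,b}(f_m).$$
   Context: All functions are complex-valued. For $b>0$, $n\in\mathbb{N}_0$, $\alpha\geq 0$, let $C^n_\alpha([b,\infty)):=\{f\in C^n([b,\infty)) : \text{there is } M\geq 0 \text{ with } |f^{(n)}(y)|\leq My^\alpha \text{ for all } y\in[b,\infty)\}$, with norm $$\Vert f\Vert_{C_\alpha^n([b,\infty))}:=\sum_{k=0}^{n-1}\frac{|f^{(k)}(b)|}{b^{n-k+\alpha}}+\sup_{y\in[b,\infty)}\frac{|f^{(n)}(y)|}{y^\alpha}.$$ For $n>\alpha+1$ and $f\in C^n_\alpha([b,\infty))$ the oscillatory integral is $$\mathcal{I}_{a,b}(f):=\lim_{\varepsilon\to 0^+}\int_b^\infty e^{-\varepsilon(y-y_0)^2}e^{iay^2}f(y)\,dy,$$ a limit which exists and is independent of $y_0\in\mathbb{R}$. *)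

(* Defs.v *)
From Stdlib Require Import Reals List.
From Coquelicot Require Import Coquelicot.

Local Open Scope R_scope.

(** A function on [[b, oo)] is represented by a total function [R -> C]; every
    notion below depends only on its values on [[b, oo)]. *)

Definition half_line (b : R) : R -> Prop := fun y => b <= y.

(** The filter [within (half_line b) (locally y)] makes the derivative
    one-sided at [y = b] and two-sided at [y > b]. *)
Definition is_derive_from (b : R) (f : R -> C) (y : R) (l : C) : Prop :=
  filterdiff (V := C_R_NormedModule) f (within (half_line b) (locally y))
    (fun h : R => scal h l).

Definition Derive_from (b : R) (f : R -> C) (y : R) : C :=
  iota (T := C_R_CompleteNormedModule) (is_derive_from b f y).

Fixpoint Derive_n_from (b : R) (f : R -> C) (k : nat) : R -> C :=
  match k with
  | O => f
  | S j => Derive_from b (Derive_n_from b f j)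
  end.

Definition is_Cn (n : nat) (b : R) (f : R -> C) : Prop :=
  (forall (k : nat) (y : R), (k < n)%nat -> b <= y ->
     exists l : C, is_derive_from b (Derive_n_from b f k) y l) /\
  continuous_on (half_line b) (Derive_n_from b f n).

Definition is_Cn_alpha (n : nat) (alpha b : R) (f : R -> C) : Prop :=
  is_Cn n b f /\
  exists M : R, 0 <= M /\
    forall y : R, b <= y ->
      Cmod (Derive_n_from b f n y) <= M * Rpower y alpha.

(** The supremum is finite, so that [real] does not alter it, as soon as
    [is_Cn_alpha n alpha b f] holds with [0 < b]. *)
Definition Cn_alpha_norm (n : nat) (alpha b : R) (f : R -> C) : R :=
  fold_right Rplus 0
    (map (fun k : nat =>
            Cmod (Derive_n_from b f k b) / Rpower b (INR (n - k) + alpha))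
       (seq 0 n))
  + real (Lub_Rbar (fun r : R => exists y : R, b <= y /\
            r = Cmod (Derive_n_from b f n y) / Rpower y alpha)).

Definition exp_i (t : R) : C := (cos t, sin t).

Definition regularized_integral
    (a b y0 : R) (f : R -> C) (eps : R) : C :=
  RInt_gen (V := C_R_CompleteNormedModule)
    (fun y : R =>
       (RtoC (exp (- eps * (y - y0) ^ 2)) * exp_i (a * y ^ 2) * f y)%C)
    (at_point b) (Rbar_locally p_infty).

Definition is_oscillatory_integral
    (a b : R) (f : R -> C) (l : C) : Prop :=
  forall y0 : R,
    filterlim (regularized_integral a b y0 f) (at_right 0) (locally l).

(** The limit is required to be the same for all [y0], so the value does not
    depend on a choice of [y0]. *)
Definition oscillatory_integral (a b : R) (f : R -> C) : C :=
  iota (T := C_R_CompleteNormedModule) (is_oscillatory_integral a b f).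

(* Main.v *)
Require Import Defs.
From Stdlib Require Import Reals Lra Lia List.
From Coquelicot Require Import Coquelicot.

(** Write [phi] for the regularized phase [exp (- eps (y - y0)^2 + i a y^2)].  It
    satisfies [phi' = p phi] with [p y = - 2 eps (y - y0) + 2 i a y], an affine
    function with [|p y| >= 2 |a| y], uniformly in [eps] and [y0].  Put [q = 1 / p];
    then [q' = c q^2] for the constant [c = - p'], and the kernels
    [W_r = phi q^r] satisfy ([is_derive_kernel])

      [W_(r+1)' = W_r + (r + 1) c W_(r+2)].

    Integrating by parts once therefore gives ([kernel_limit_by_parts])

      [int W_r h = - W_(r+1)(b) h(b) - int W_(r+1) h' - (r + 1) c int W_(r+2) h];

    the boundary term at infinity vanishes because of the Gaussian factor.  If
    [|h^(k)(y)| <= M y^(beta - k)], both integrands on the right are smaller than the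
    one on the left by a factor [y^(-2)].  After [N] steps every remaining integral
    has an integrand bounded by a multiple of [M y^(beta - r - 2 N)], and converges
    absolutely once this exponent is below [-1].  In that case the limit
    [eps -> 0+] exists and is at most a constant times [M] ([kernel_limit_absolute]):
    the kernel at [eps] differs from the one at [eps = 0] by at most a multiple of
    [eps^theta y^(2 theta - r)] ([kernel_diff]), and a small [theta > 0] keeps this
    integrable against [h].  Since the limiting kernel does not involve [y0],
    neither does the limit.

    A function in [C^n_alpha] falls under this with [r = 0], [N = n] and
    [beta = alpha + n], where [beta - 2 n = alpha - n < -1]; the bounds on the lower
    derivatives, with [M] a multiple of the norm, come from integrating the bound on
    the [n]-th one ([Cn_alpha_jet]).  So the oscillatory integral is a linear
    functional bounded by a multiple of the norm, and bounded linear functionals are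
    continuous. *)

Local Open Scope R_scope.

Local Notation is_deriveC := (is_derive (V := C_R_NormedModule)).
Local Notation scalC := (scal (V := C_R_NormedModule)).
Local Notation continuousC := (continuous (U := C_R_NormedModule)).
Local Notation RIntC := (RInt (V := C_R_CompleteNormedModule)).
Local Notation RIntC_gen := (RInt_gen (V := C_R_CompleteNormedModule)).

(** * Functions of a real variable with complex values *)

Lemma norm_C_R (z : C) : norm (V := C_R_NormedModule) z = Cmod z.
Proof. symmetry. apply Cmod_norm. Qed.

Lemma filterlim_C {T : Type} (F : (T -> Prop) -> Prop) {FF : Filter F} (f : T -> C) (l : C) :
  filterlim f F (locally l) <-> forall eps : R, 0 < eps -> F (fun x => Cmod (f x - l) < eps).
Proof.
  rewrite (filterlim_locally_ball_norm (K := R_AbsRing) (U := C_R_NormedModule) f l).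
  split; intros H.
  - intros eps Heps. generalize (H (mkposreal eps Heps)). apply filter_imp.
    intros x Hx. unfold ball_norm in Hx. rewrite norm_C_R in Hx. exact Hx.
  - intros [eps Heps]. generalize (H eps Heps). apply filter_imp.
    intros x Hx. unfold ball_norm. rewrite norm_C_R. exact Hx.
Qed.

Lemma RtoC_mult_scal (u : R) (l : C) :
  (RtoC u * l)%C = scal (K := R_AbsRing) (V := C_R_NormedModule) u l.
Proof.
  unfold scal; simpl; unfold prod_scal, scal; simpl; unfold mult; simpl.
  unfold Cmult, RtoC; simpl. f_equal; ring.
Qed.

(** The filter in [is_derive_from] restricts the points to [half_line b]; it has [y]
    as its only limit because [y] itself belongs to the half-line. *)
Lemma is_derive_from_eps (b : R) (f : R -> C) (y : R) (l : C) : b <= y ->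
  is_derive_from b f y l <->
  forall eps : R, 0 < eps -> exists delta, 0 < delta /\ forall t, b <= t -> Rabs (t - y) < delta ->
     Cmod (f t - f y - RtoC (t - y) * l)%C <= eps * Rabs (t - y).
Proof.
  intros Hy.
  split.
  - intros [_ H] eps Heps.
    specialize (H y).
    assert (Hl : is_filter_lim (within (half_line b) (locally y)) y).
    { intros P HP. apply filter_le_within. exact HP. }
    destruct (H Hl (mkposreal eps Heps)) as [d Hd].
    exists d. split. apply cond_pos.
    intros t Ht Htd. specialize (Hd t Htd Ht).
    rewrite RtoC_mult_scal, <- norm_C_R. exact Hd.
  - intros H. split.
    + exact (is_linear_scal_l (K := R_AbsRing) (V := C_R_NormedModule) l).
    + intros x Hx.
      assert (x = y).
      { destruct (Req_dec x y) as [|Hne]; auto. exfalso.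
        assert (Hd : 0 < Rabs (x - y)) by (apply Rabs_pos_lt; lra).
        assert (Hd2 : 0 < Rabs (x - y) / 2) by lra.
        destruct (Hx (fun t => Rabs (t - x) < Rabs (x - y) / 2)) as [d Hdl].
        { exists (mkposreal _ Hd2). intros t Ht. exact Ht. }
        specialize (Hdl y (ball_center y d) Hy). simpl in Hdl.
        rewrite (Rabs_minus_sym y x) in Hdl. lra. }
      subst x. intros [eps Heps]. destruct (H eps Heps) as (d & Hd & Hdl).
      exists (mkposreal d Hd). intros t Ht Hbt.
      specialize (Hdl t Hbt Ht). rewrite RtoC_mult_scal, <- norm_C_R in Hdl. exact Hdl.
Qed.

Lemma is_derive_eps (f : R -> C) (y : R) (l : C) :
  is_deriveC f y l <->
  forall eps : R, 0 < eps -> exists delta, 0 < delta /\ forall t, Rabs (t - y) < delta ->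
     Cmod (f t - f y - RtoC (t - y) * l)%C <= eps * Rabs (t - y).
Proof.
  split.
  - intros [_ H] eps Heps.
    destruct (H y (fun P HP => HP) (mkposreal eps Heps)) as [d Hd].
    exists d. split. apply cond_pos.
    intros t Htd. specialize (Hd t Htd).
    rewrite RtoC_mult_scal, <- norm_C_R. exact Hd.
  - intros H. split.
    + exact (is_linear_scal_l (K := R_AbsRing) (V := C_R_NormedModule) l).
    + intros x Hx. apply (is_filter_lim_locally_unique (V:=R_NormedModule)) in Hx. subst x.
      intros [eps Heps]. destruct (H eps Heps) as (d & Hd & Hdl).
      exists (mkposreal d Hd). intros t Ht.
      specialize (Hdl t Ht). rewrite RtoC_mult_scal, <- norm_C_R in Hdl. exact Hdl.
Qed.

(** Differentiating a pair is differentiating the combination of the constant vectors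
    [1] and [i] with the real coordinates as coefficients. *)
Lemma is_derive_C (u v : R -> R) (y du dv : R) :
  is_derive u y du -> is_derive v y dv ->
  is_deriveC (fun t => (u t, v t) : C) y (du, dv).
Proof.
  intros Hu Hv.
  assert (H : is_deriveC
    (fun t => plus (scalC (u t) (1, 0)) (scalC (v t) (0, 1))) y
    (plus (scalC du (1, 0)) (scalC dv (0, 1)))).
  { apply @is_derive_plus; apply @is_derive_scal_l; assumption. }
  assert (E : forall x z : R, plus (scalC x (1, 0)) (scalC z (0, 1)) = (x, z)).
  { intros x z. unfold plus, scal; simpl. unfold prod_plus, prod_scal, plus, scal; simpl.
    unfold mult; simpl. f_equal; ring. }
  rewrite E in H. eapply is_derive_ext; [|exact H]. intros t. apply E.
Qed.

Lemma is_derive_fst (f : R -> C) (y : R) (l : C) :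
  is_deriveC f y l -> is_derive (fun t => fst (f t)) y (fst l).
Proof.
  intros H.
  exact (filterdiff_comp' (U := R_NormedModule) (V := C_R_NormedModule) (W := R_NormedModule)
   f fst y _ _ H (filterdiff_linear _ (is_linear_fst (U := R_NormedModule) (V := R_NormedModule)))).
Qed.

Lemma is_derive_snd (f : R -> C) (y : R) (l : C) :
  is_deriveC f y l -> is_derive (fun t => snd (f t)) y (snd l).
Proof.
  intros H.
  exact (filterdiff_comp' (U := R_NormedModule) (V := C_R_NormedModule) (W := R_NormedModule)
   f snd y _ _ H (filterdiff_linear _ (is_linear_snd (U := R_NormedModule) (V := R_NormedModule)))).
Qed.

(** [R -> C] is a space of functions into a real vector space, where the product of
    two values is not a scalar multiplication; hence the passage to coordinates. *)
Lemma is_derive_Cmult (f g : R -> C) (y : R) (df dg : C) :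
  is_deriveC f y df -> is_deriveC g y dg ->
  is_deriveC (fun t => f t * g t)%C y (df * g y + f y * dg)%C.
Proof.
  intros Hf Hg.
  pose proof (is_derive_fst _ _ _ Hf) as Hf1. pose proof (is_derive_snd _ _ _ Hf) as Hf2.
  pose proof (is_derive_fst _ _ _ Hg) as Hg1. pose proof (is_derive_snd _ _ _ Hg) as Hg2.
  unfold Cmult at 1.
  replace (df * g y + f y * dg)%C with
   (minus (plus (scal (fst df) (fst (g y))) (scal (fst (f y)) (fst dg)))
      (plus (scal (snd df) (snd (g y))) (scal (snd (f y)) (snd dg))),
    plus (plus (scal (fst df) (snd (g y))) (scal (fst (f y)) (snd dg)))
      (plus (scal (snd df) (fst (g y))) (scal (snd (f y)) (fst dg)))).
  2: { unfold minus, plus, opp, scal; simpl; unfold mult; simpl.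
       unfold Cplus, Cmult; simpl. f_equal; ring. }
  apply (is_derive_C (fun t => fst (f t) * fst (g t) - snd (f t) * snd (g t))
    (fun t => fst (f t) * snd (g t) + snd (f t) * fst (g t))).
  - apply @is_derive_minus; apply (is_derive_mult (K:=R_AbsRing)); auto; intros; apply Rmult_comm.
  - apply @is_derive_plus; apply (is_derive_mult (K:=R_AbsRing)); auto; intros; apply Rmult_comm.
Qed.

Lemma continuous_Cmult (f g : R -> C) (y : R) :
  continuousC f y -> continuousC g y ->
  continuousC (fun t => f t * g t)%C y.
Proof.
  intros Hf Hg.
  assert (Hfs : forall h : R -> C, continuousC h y ->
    continuous (fun t => fst (h t)) y /\ continuous (fun t => snd (h t)) y).
  { intros h Hh. split.
    - apply (continuous_comp (V := C_UniformSpace) (W := R_UniformSpace) h fst y Hh).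
      apply continuous_fst.
    - apply (continuous_comp (V := C_UniformSpace) (W := R_UniformSpace) h snd y Hh).
      apply continuous_snd. }
  destruct (Hfs f Hf) as [Hf1 Hf2], (Hfs g Hg) as [Hg1 Hg2].
  assert (Hp : forall u v : R -> R, continuous u y -> continuous v y ->
    continuousC (fun t => (u t, v t) : C) y).
  { intros u v Hu Hv. intros P [eps HP].
    destruct (Hu _ (locally_ball (u y) eps)) as [d1 H1].
    destruct (Hv _ (locally_ball (v y) eps)) as [d2 H2].
    unfold filtermap. generalize (filter_and _ _ (locally_ball y d1) (locally_ball y d2)).
    apply filter_imp. intros t [A B]. apply HP. split; simpl; auto. }
  unfold Cmult. apply (Hp (fun t => fst (f t) * fst (g t) - snd (f t) * snd (g t))
    (fun t => fst (f t) * snd (g t) + snd (f t) * fst (g t))).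
  - apply @continuous_minus; apply (continuous_mult (K:=R_AbsRing)); assumption.
  - apply @continuous_plus; apply (continuous_mult (K:=R_AbsRing)); assumption.
Qed.

(** * One-sided derivatives on the half-line *)

(** The half-line contains points [y + s] with [s > 0] arbitrarily small, where both
    linear approximations are within [eps s / 2] of the increment. *)
Lemma is_derive_from_unique (b : R) (f : R -> C) (y : R) (l1 l2 : C) : b <= y ->
  is_derive_from b f y l1 -> is_derive_from b f y l2 -> l1 = l2.
Proof.
  intros Hy H1 H2. rewrite is_derive_from_eps in H1, H2 by assumption.
  assert (H : Cmod (l1 - l2) <= 0).
  { apply le_epsilon. intros eps Heps. rewrite Rplus_0_l.
    destruct (H1 (eps / 2)) as (d1 & Hd1 & K1); [lra|].
    destruct (H2 (eps / 2)) as (d2 & Hd2 & K2); [lra|].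
    set (s := Rmin d1 d2 / 2).
    assert (Hs : 0 < s) by (unfold s, Rmin; destruct Rle_dec; lra).
    assert (Hs12 : s < d1 /\ s < d2) by (unfold s, Rmin; destruct Rle_dec; lra).
    specialize (K1 (y + s)). specialize (K2 (y + s)).
    replace (y + s - y) with s in * by ring. rewrite (Rabs_pos_eq s) in * by lra.
    specialize (K1 ltac:(lra) ltac:(lra)). specialize (K2 ltac:(lra) ltac:(lra)).
    assert (s * Cmod (l1 - l2) <= s * eps).
    { assert (E : (RtoC s * (l1 - l2) =
        (f (y + s)%R - f y - s * l2) + - (f (y + s)%R - f y - s * l1))%C) by ring.
      rewrite <- (Rabs_pos_eq s) at 1 by lra. rewrite <- Cmod_R, <- Cmod_mult, E.
      eapply Rle_trans; [apply Cmod_triangle|]. rewrite Cmod_opp. lra. }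
    apply Rmult_le_reg_l with s; lra. }
  assert (Hz : (l1 - l2)%C = 0). { apply Cmod_eq_0. apply Rle_antisym; auto using Cmod_ge_0. }
  replace l1 with ((l1 - l2) + l2)%C by ring. rewrite Hz. ring.
Qed.

Lemma Derive_from_eq (b : R) (f : R -> C) (y : R) (l : C) : b <= y ->
  is_derive_from b f y l -> Derive_from b f y = l.
Proof.
  intros Hy H. apply (iota_unique (V := C_R_CompleteNormedModule)); auto. intros l' H'.
  apply is_derive_from_unique with b f y; auto.
Qed.

Lemma is_derive_from_minus (b : R) (f g h : R -> C) (y : R) (df dg : C) : b <= y ->
  (forall t, b <= t -> h t = f t - g t)%C ->
  is_derive_from b f y df -> is_derive_from b g y dg -> is_derive_from b h y (df - dg)%C.
Proof.
  intros Hy Hh Hf Hg. rewrite is_derive_from_eps in * by assumption.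
  intros eps Heps.
  destruct (Hf (eps / 2)) as (d1 & Hd1 & K1); [lra|].
  destruct (Hg (eps / 2)) as (d2 & Hd2 & K2); [lra|].
  exists (Rmin d1 d2). split. { apply Rmin_pos; assumption. }
  intros t Ht Htd. rewrite 2!Hh by assumption.
  specialize (K1 t Ht (Rlt_le_trans _ _ _ Htd (Rmin_l _ _))).
  specialize (K2 t Ht (Rlt_le_trans _ _ _ Htd (Rmin_r _ _))).
  replace (f t - g t - (f y - g y) - (t - y)%R * (df - dg))%C
    with ((f t - f y - (t - y)%R * df) + - (g t - g y - (t - y)%R * dg))%C by ring.
  eapply Rle_trans. apply Cmod_triangle. rewrite Cmod_opp. lra.
Qed.

Lemma Derive_n_from_derive (n : nat) (b : R) (f : R -> C) : is_Cn n b f ->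
  forall k y, (k < n)%nat -> b <= y ->
    is_derive_from b (Derive_n_from b f k) y (Derive_n_from b f (S k) y).
Proof.
  intros [H _] k y Hk Hy. destruct (H k y Hk Hy) as [l Hl].
  simpl. rewrite (Derive_from_eq _ _ _ _ Hy Hl). exact Hl.
Qed.

Lemma Derive_n_from_minus (n : nat) (b : R) (f g : R -> C) : is_Cn n b f -> is_Cn n b g ->
  forall k y, (k <= n)%nat -> b <= y ->
    Derive_n_from b (fun t => f t - g t)%C k y = (Derive_n_from b f k y - Derive_n_from b g k y)%C.
Proof.
  intros Hf Hg. induction k as [|k IH]; intros y Hk Hy; [reflexivity|].
  cbn [Derive_n_from]. apply Derive_from_eq; auto.
  apply is_derive_from_minus with (f := Derive_n_from b f k) (g := Derive_n_from b g k); auto.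
  - intros t Ht. apply IH; auto; lia.
  - apply (Derive_n_from_derive n b f Hf); auto.
  - apply (Derive_n_from_derive n b g Hg); auto.
Qed.

Lemma continuous_on_half_line_eps (b : R) (f : R -> C) :
  continuous_on (half_line b) f <-> forall y, b <= y ->
  forall eps : R, 0 < eps -> exists delta, 0 < delta /\ forall t, b <= t -> Rabs (t - y) < delta ->
     Cmod (f t - f y)%C < eps.
Proof.
  split.
  - intros H y Hy eps Heps.
    destruct (proj1 (filterlim_C _ _ _) (H y Hy) eps Heps) as [d Hd].
    exists d. split. apply cond_pos. intros t Ht Htd. apply Hd; auto.
  - intros H y Hy. apply filterlim_C. apply within_filter, locally_filter.
    intros eps Heps. destruct (H y Hy eps Heps) as (d & Hd & K).
    exists (mkposreal d Hd). intros t Ht Hbt. apply K; auto.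
Qed.

Lemma is_Cn_minus (n : nat) (b : R) (f g : R -> C) : is_Cn n b f -> is_Cn n b g ->
  is_Cn n b (fun t => f t - g t)%C.
Proof.
  intros Hf Hg. split.
  - intros k y Hk Hy. eexists.
    apply is_derive_from_minus with (f := Derive_n_from b f k) (g := Derive_n_from b g k); auto.
    + intros t Ht. apply (Derive_n_from_minus n); auto; lia.
    + apply (Derive_n_from_derive n b f Hf); auto.
    + apply (Derive_n_from_derive n b g Hg); auto.
  - destruct Hf as [Hf1 Hf2], Hg as [Hg1 Hg2].
    pose proof (proj1 (continuous_on_half_line_eps _ _) Hf2) as Kf.
    pose proof (proj1 (continuous_on_half_line_eps _ _) Hg2) as Kg.
    apply continuous_on_half_line_eps. intros y Hy eps Heps.
    destruct (Kf y Hy (eps / 2)) as (d1 & Hd1 & K1); [lra|].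
    destruct (Kg y Hy (eps / 2)) as (d2 & Hd2 & K2); [lra|].
    exists (Rmin d1 d2). split. { apply Rmin_pos; assumption. }
    intros t Ht Htd. rewrite 2!(Derive_n_from_minus n) by (auto; split; auto).
    specialize (K1 t Ht (Rlt_le_trans _ _ _ Htd (Rmin_l _ _))).
    specialize (K2 t Ht (Rlt_le_trans _ _ _ Htd (Rmin_r _ _))).
    match goal with |- Cmod ?z < _ => replace z with
      ((Derive_n_from b f n t - Derive_n_from b f n y) + - (Derive_n_from b g n t
        - Derive_n_from b g n y))%C by ring end.
    eapply Rle_lt_trans. apply Cmod_triangle. rewrite Cmod_opp. lra.
Qed.

Lemma is_Cn_alpha_minus (n : nat) (alpha b : R) (f g : R -> C) :
  is_Cn_alpha n alpha b f -> is_Cn_alpha n alpha b g ->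
  is_Cn_alpha n alpha b (fun t => f t - g t)%C.
Proof.
  intros (Hf & M1 & HM1 & B1) (Hg & M2 & HM2 & B2). split. apply is_Cn_minus; auto.
  exists (M1 + M2). split. lra. intros y Hy. rewrite (Derive_n_from_minus n) by auto.
  eapply Rle_trans. apply Cmod_triangle. rewrite Cmod_opp.
  specialize (B1 y Hy). specialize (B2 y Hy). lra.
Qed.

(** For continuing a function across the end point [b]: at [b] each half of the
    difference quotient is controlled by one of the two functions. *)
Lemma is_derive_glue (b : R) (g h d : R -> C) :
  (forall y, y <= b -> is_deriveC g y (d y)) ->
  (forall y, b <= y -> is_derive_from b h y (d y)) -> g b = h b ->
  forall y, is_deriveC (fun t => if Rle_dec b t then h t else g t) y (d y).
Proof.
  intros Hg Hh E y. apply is_derive_eps. intros eps Heps.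
  destruct (Rtotal_order y b) as [Hy|[Hy|Hy]].
  - destruct (proj1 (is_derive_eps _ _ _) (Hg y (Rlt_le _ _ Hy)) eps Heps) as (e & He & K).
    exists (Rmin e (b - y)). split. { apply Rmin_pos; lra. }
    intros t Ht. specialize (K t (Rlt_le_trans _ _ _ Ht (Rmin_l _ _))).
    pose proof (Rlt_le_trans _ _ _ Ht (Rmin_r _ _)) as Ht2. apply Rabs_def2 in Ht2.
    destruct (Rle_dec b t); [lra|]. destruct (Rle_dec b y); [lra|]. exact K.
  - subst y.
    destruct (proj1 (is_derive_eps _ _ _) (Hg b (Rle_refl _)) eps Heps) as (e & He & K).
    destruct (proj1 (is_derive_from_eps b _ _ _ (Rle_refl b))
      (Hh b (Rle_refl _)) eps Heps) as (e' & He' & K').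
    exists (Rmin e e'). split. { apply Rmin_pos; lra. }
    intros t Ht. destruct (Rle_dec b b); [|lra].
    destruct (Rle_dec b t) as [Hbt|Hbt].
    + apply K'; auto. apply (Rlt_le_trans _ _ _ Ht (Rmin_r _ _)).
    + rewrite <- E. apply K. apply (Rlt_le_trans _ _ _ Ht (Rmin_l _ _)).
  - destruct (proj1 (is_derive_from_eps b _ _ _ (Rlt_le _ _ Hy))
    (Hh y (Rlt_le _ _ Hy)) eps Heps) as (e & He & K).
    exists (Rmin e (y - b)). split. { apply Rmin_pos; lra. }
    intros t Ht.
    pose proof (Rlt_le_trans _ _ _ Ht (Rmin_r _ _)) as Ht2. apply Rabs_def2 in Ht2.
    destruct (Rle_dec b t); [|lra]. destruct (Rle_dec b y); [|lra]. apply K; auto.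
    apply (Rlt_le_trans _ _ _ Ht (Rmin_l _ _)).
Qed.

Lemma is_derive_continuous_C (f : R -> C) (y : R) (l : C) :
  is_deriveC f y l -> continuousC f y.
Proof. intros H. apply ex_derive_continuous. exists l. exact H. Qed.

Lemma is_derive_RInt_C (f : R -> C) (a y : R) : (forall t, continuousC f t) ->
  is_deriveC (fun t => RIntC f a t) y (f y).
Proof.
  intros Hc. apply (is_derive_RInt (V := C_R_NormedModule) f _ a y); auto.
  apply filter_forall. intros t. apply (RInt_correct (V := C_R_CompleteNormedModule)).
  apply (ex_RInt_continuous (V := C_R_CompleteNormedModule)). intros; apply Hc.
Qed.

(** Trades one-sided derivatives for ordinary ones, for which the product rule and the
    fundamental theorem of calculus are available.  The top derivative is continued by
    its value at [b], and the lower ones by successive primitives. *)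
Lemma jet_extension (N : nat) (b : R) : forall h : nat -> R -> C,
  (forall k y, (k < N)%nat -> b <= y -> is_derive_from b (h k) y (h (S k) y)) ->
  continuous_on (half_line b) (h N) ->
  exists H : nat -> R -> C,
    (forall k y, (k <= N)%nat -> b <= y -> H k y = h k y) /\
    (forall k y, (k < N)%nat -> is_deriveC (H k) y (H (S k) y)) /\
    (forall y, continuousC (H N) y).
Proof.
  induction N as [|N IH]; intros h Hd Hc.
  - exists (fun _ y => h 0%nat (Rmax b y)). split; [|split].
    + intros k y Hk Hy. replace k with 0%nat by lia. now rewrite Rmax_right.
    + intros; lia.
    + intros y. apply filterlim_C. apply locally_filter. intros eps Heps.
      destruct (proj1 (continuous_on_half_line_eps _ _) Hc (Rmax b y)
        (Rmax_l _ _) eps Heps) as (d & Hdp & K).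
      exists (mkposreal d Hdp). intros t Ht. apply K. apply Rmax_l.
      change (Rabs (t - y) < d) in Ht. apply Rabs_def2 in Ht.
      apply Rabs_def1; unfold Rmax; repeat destruct Rle_dec; lra.
  - destruct (IH (fun k => h (S k))) as (H & HE & HD & HC).
    { intros k y Hk Hy. apply Hd; auto; lia. } { exact Hc. }
    assert (C0 : forall t, continuousC (H 0%nat) t).
    { intros t. destruct N. apply HC. eapply is_derive_continuous_C. apply HD. lia. }
    exists (fun k => match k with O => fun t => if Rle_dec b t then h 0%nat t else
       (h 0%nat b + RIntC (H 0%nat) b t)%C | S k => H k end).
    split; [|split].
    + intros [|k] y Hk Hy. { destruct (Rle_dec b y); [reflexivity | lra]. } apply HE; auto; lia.
    + intros [|k] y Hk; [|apply HD; lia].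
      apply is_derive_glue with (d := H 0%nat).
      * intros t Ht. rewrite <- (Cplus_0_l (H 0%nat t)).
        apply (is_derive_plus (V := C_R_NormedModule));
          [apply (is_derive_const (V := C_R_NormedModule))|].
        apply is_derive_RInt_C; auto.
      * intros t Ht. rewrite HE by (auto; lia). apply Hd; auto; lia.
      * rewrite RInt_point. apply (plus_zero_r (G := C_R_NormedModule)).
    + exact HC.
Qed.

(** * Improper integrals over the half-line *)

Lemma Cmod_lim_le {T : Type} (F : (T -> Prop) -> Prop) {FF : ProperFilter F}
    (f : T -> C) (l : C) (M : R) :
  filterlim f F (locally l) -> F (fun x => Cmod (f x) <= M) -> Cmod l <= M.
Proof.
  intros Hl HM. apply le_epsilon. intros eps Heps.
  destruct (filter_ex _ (filter_and _ _ HM (proj1 (filterlim_C F f l) Hl eps Heps)))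
    as (x & H1 & H2).
  replace l with (f x + - (f x - l))%C by ring.
  eapply Rle_trans; [apply Cmod_triangle|]. rewrite Cmod_opp. lra.
Qed.

Lemma filterlim_Cplus {T : Type} (F : (T -> Prop) -> Prop) {FF : Filter F}
    (f g : T -> C) (l m : C) :
  filterlim f F (locally l) -> filterlim g F (locally m) ->
    filterlim (fun x => f x + g x)%C F (locally (l + m)%C).
Proof.
  intros Hf Hg. eapply filterlim_comp_2; [exact Hf | exact Hg |].
  apply (filterlim_plus (V := C_R_NormedModule)).
Qed.

Lemma filterlim_Copp {T : Type} (F : (T -> Prop) -> Prop) {FF : Filter F} (f : T -> C) (l : C) :
  filterlim f F (locally l) -> filterlim (fun x => - f x)%C F (locally (- l)%C).
Proof.
  intros Hf. eapply filterlim_comp; [exact Hf|]. apply (filterlim_opp (V := C_R_NormedModule)).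
Qed.

Lemma filterlim_Cmult {T : Type} (F : (T -> Prop) -> Prop) {FF : Filter F}
    (f g : T -> C) (l m : C) :
  filterlim f F (locally l) -> filterlim g F (locally m) ->
    filterlim (fun x => f x * g x)%C F (locally (l * m)%C).
Proof.
  intros Hf Hg. apply filterlim_C; [exact FF|]. intros eps Heps.
  pose proof (proj1 (filterlim_C F f l) Hf) as Kf. pose proof (proj1 (filterlim_C F g m) Hg) as Kg.
  set (K := Cmod l + Cmod m + 1).
  assert (HK : 0 < K). { unfold K. pose proof (Cmod_ge_0 l). pose proof (Cmod_ge_0 m). lra. }
  assert (He : 0 < Rmin 1 (eps / K)). { apply Rmin_pos. lra. now apply Rdiv_lt_0_compat. }
  generalize (filter_and _ _ (Kf _ He) (Kg _ He)). apply filter_imp.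
  intros x [H1 H2].
  assert (H3 : Cmod (f x) <= Cmod l + 1).
  { replace (f x) with ((f x - l) + l)%C by ring. eapply Rle_trans; [apply Cmod_triangle|].
    pose proof (Rmin_l 1 (eps / K)). lra. }
  replace (f x * g x - l * m)%C with (f x * (g x - m) + (f x - l) * m)%C by ring.
  eapply Rle_lt_trans; [apply Cmod_triangle|]. rewrite 2!Cmod_mult.
  assert (Hk : eps = K * (eps / K)) by (field; lra).
  pose proof (Rmin_r 1 (eps / K)).
  pose proof (Cmod_ge_0 (f x)). pose proof (Cmod_ge_0 m).
  pose proof (Cmod_ge_0 (f x - l)). pose proof (Cmod_ge_0 (g x - m)). pose proof (Cmod_ge_0 l).
  apply Rle_lt_trans with ((Cmod l + 1) * Cmod (g x - m) + Cmod (f x - l) * Cmod m).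
  { apply Rplus_le_compat_r. apply Rmult_le_compat_r; auto. }
  rewrite Hk. unfold K at 1. set (d := eps / K) in *.
  assert (Cmod (f x - l) * Cmod m <= d * Cmod m) by (apply Rmult_le_compat_r; lra).
  assert ((Cmod l + 1) * Cmod (g x - m) < (Cmod l + 1) * d) by (apply Rmult_lt_compat_l; lra).
  lra.
Qed.

(** Convergence need not be absolute, so a derivative is integrable as soon as its
    primitive has a limit at infinity. *)
Definition is_improper (b : R) (F : R -> C) (l : C) : Prop :=
  filterlim (fun Y => RIntC F b Y) (Rbar_locally p_infty) (locally l).

Definition continuous_from (b : R) (F : R -> C) : Prop :=
  forall y, b <= y -> continuousC F y.

Lemma ex_RInt_from (b : R) (F : R -> C) (Y Z : R) : continuous_from b F -> b <= Y -> b <= Z ->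
  ex_RInt (V := C_R_CompleteNormedModule) F Y Z.
Proof.
  intros HF HY HZ. apply (ex_RInt_continuous (V := C_R_CompleteNormedModule)).
  intros z [Hz _]. apply HF. eapply Rle_trans; [|exact Hz]. apply Rmin_glb; assumption.
Qed.

Lemma eventually_ge (b : R) : Rbar_locally p_infty (fun Y => b <= Y).
Proof. exists b. intros x Hx. lra. Qed.

Lemma improper_unique (b : R) (F : R -> C) (l m : C) : is_improper b F l -> is_improper b F m ->
    l = m.
Proof. apply (filterlim_locally_unique (V := C_R_NormedModule)). Qed.

Lemma improper_ext (b : R) (F G : R -> C) (l : C) : (forall y, b <= y -> F y = G y) ->
  is_improper b F l -> is_improper b G l.
Proof.
  intros E. apply filterlim_ext_loc. generalize (eventually_ge b). apply filter_imp.
  intros Y HY. apply (RInt_ext (V := C_R_CompleteNormedModule)). intros x Hx.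
  rewrite Rmin_left, Rmax_right in Hx by assumption. apply E. lra.
Qed.

Lemma improper_plus (b : R) (F G : R -> C) (l m : C) : continuous_from b F -> continuous_from b G ->
  is_improper b F l -> is_improper b G m -> is_improper b (fun y => F y + G y)%C (l + m)%C.
Proof.
  intros HF HG Hl Hm. eapply filterlim_ext_loc; [|exact (filterlim_Cplus _ _ _ _ _ Hl Hm)].
  generalize (eventually_ge b). apply filter_imp. intros Y HY. symmetry.
  apply (RInt_plus (V := C_R_CompleteNormedModule)); apply (ex_RInt_from b); auto; lra.
Qed.

(** [RInt] is linear over the real scalars only, so a complex factor has to be split
    into its coordinates. *)
Lemma improper_Cmult (b : R) (F : R -> C) (c l : C) : continuous_from b F ->
  is_improper b F l -> is_improper b (fun y => c * F y)%C (c * l)%C.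
Proof.
  intros HF Hl. eapply filterlim_ext_loc;
    [|exact (filterlim_Cmult _ _ _ _ _ (filterlim_const (U := C_UniformSpace) c) Hl)].
  generalize (eventually_ge b). apply filter_imp. intros Y HY. symmetry.
  apply (is_RInt_unique (V := C_R_CompleteNormedModule)).
  destruct (RIntC F b Y) as [u v] eqn:E.
  assert (H := RInt_correct (V := C_R_CompleteNormedModule) F b Y
    (ex_RInt_from b F b Y HF (Rle_refl b) HY)).
  rewrite E in H.
  assert (H1 := is_RInt_fct_extend_fst _ _ _ _ H). assert (H2 := is_RInt_fct_extend_snd _ _ _ _ H).
  simpl in H1, H2.
  apply (is_RInt_fct_extend_pair (U := R_NormedModule) (V := R_NormedModule)).
  - apply (is_RInt_minus (V := R_NormedModule)); apply (is_RInt_scal (V := R_NormedModule));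
    assumption.
  - apply (is_RInt_plus (V := R_NormedModule)); apply (is_RInt_scal (V := R_NormedModule));
    assumption.
Qed.

Lemma improper_derive (b : R) (F G : R -> C) : continuous_from b F ->
  (forall y, b <= y -> is_deriveC G y (F y)) ->
  filterlim G (Rbar_locally p_infty) (locally (0 : C)) ->
  is_improper b F (- G b)%C.
Proof.
  intros HF HG H0.
  apply filterlim_ext_loc with (fun Y => G Y + - G b)%C.
  - generalize (eventually_ge b). apply filter_imp. intros Y HY. symmetry.
    apply (is_RInt_unique (V := C_R_CompleteNormedModule)).
    apply (is_RInt_derive (V := C_R_CompleteNormedModule));
      intros x Hx; rewrite Rmin_left, Rmax_right in Hx by assumption; [apply HG | apply HF]; lra.
  - assert (H := filterlim_Cplus (Rbar_locally p_infty) _ _ _ _ H0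
      (filterlim_const (U := C_UniformSpace) (- G b)%C)).
    rewrite Cplus_0_l in H. exact H.
Qed.

Lemma is_derive_Rpower (g t : R) : 0 < t ->
    is_derive (fun x => Rpower x g) t (g * Rpower t (g - 1)).
Proof.
  intros Ht. unfold Rpower. auto_derive. exact Ht.
  replace ((g - 1) * ln t) with (g * ln t + - ln t) by ring.
  rewrite exp_plus, exp_Ropp, exp_ln by assumption. field. lra.
Qed.

Lemma continuous_Rpower (g t : R) : 0 < t -> continuous (fun x => Rpower x g) t.
Proof.
  intros Ht. apply (ex_derive_continuous (V := R_NormedModule)).
  eexists. now apply is_derive_Rpower.
Qed.

Lemma is_RInt_Rpower (g Y Z : R) : g < -1 -> 0 < Y -> Y <= Z ->
  is_RInt (fun t => Rpower t g) Y Z ((Rpower Y (g + 1) - Rpower Z (g + 1)) / (- (g + 1))).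
Proof.
  intros Hg HY HZ.
  replace ((Rpower Y (g + 1) - Rpower Z (g + 1)) / (- (g + 1))) with
    (minus (Rpower Z (g + 1) / (g + 1)) (Rpower Y (g + 1) / (g + 1))).
  2: { unfold minus, plus, opp; simpl. field. lra. }
  apply (is_RInt_derive (V := R_CompleteNormedModule) (fun t => Rpower t (g + 1) / (g + 1)));
   intros x Hx; rewrite Rmin_left, Rmax_right in Hx by assumption.
  - replace (Rpower x g) with (/ (g + 1) * ((g + 1) * Rpower x (g + 1 - 1))).
    2: { replace (g + 1 - 1) with g by ring. field. lra. }
    apply is_derive_ext with (fun t => / (g + 1) * Rpower t (g + 1)).
    + intros t. unfold Rdiv. apply Rmult_comm.
    + apply is_derive_scal. apply is_derive_Rpower. lra.
  - apply continuous_Rpower. lra.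
Qed.

Lemma Rpower_pos (x y : R) : 0 < Rpower x y.
Proof. apply exp_pos. Qed.

Lemma bound_constant_ge_0 (z : C) (K x g : R) : Cmod z <= K * Rpower x g -> 0 <= K.
Proof. pose proof (Cmod_ge_0 z). pose proof (Rpower_pos x g). nra. Qed.

Lemma RInt_tail_bound (b : R) (F : R -> C) (K g Y Z : R) : 0 < b -> g < -1 -> continuous_from b F ->
  (forall y, b <= y -> Cmod (F y) <= K * Rpower y g) -> b <= Y -> Y <= Z ->
  Cmod (RIntC F Y Z) <= K * (Rpower Y (g + 1) / (- (g + 1))).
Proof.
  intros Hb Hg HF HK HY HZ.
  assert (HK0 : 0 <= K).
  { exact (bound_constant_ge_0 _ _ _ _ (HK b (Rle_refl b))). }
  rewrite <- norm_C_R.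
  eapply Rle_trans.
  - apply (norm_RInt_le (V := C_R_NormedModule) F (fun t => K * Rpower t g) Y Z).
    + exact HZ.
    + intros x Hx. rewrite norm_C_R. apply HK. lra.
    + apply (RInt_correct (V := C_R_CompleteNormedModule)). apply (ex_RInt_from b); auto; lra.
    + apply (is_RInt_scal (V := R_NormedModule)). apply is_RInt_Rpower; lra.
  - apply Rmult_le_compat_l; [exact HK0|]. unfold Rdiv. apply Rmult_le_compat_r.
    + apply Rlt_le, Rinv_0_lt_compat. lra.
    + pose proof (Rpower_pos Z (g + 1)). lra.
Qed.

Lemma improper_bound (b : R) (F : R -> C) (K g : R) (l : C) : 0 < b -> g < -1 ->
    continuous_from b F ->
  (forall y, b <= y -> Cmod (F y) <= K * Rpower y g) -> is_improper b F l ->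
  Cmod l <= K * (Rpower b (g + 1) / (- (g + 1))).
Proof.
  intros Hb Hg HF HK Hl. eapply (Cmod_lim_le (Rbar_locally p_infty)); [exact Hl|].
  generalize (eventually_ge b). apply filter_imp. intros Y HY.
  apply (RInt_tail_bound b); auto; lra.
Qed.

Lemma Rpower_lim_0 (g eps : R) : g < 0 -> 0 < eps ->
    Rbar_locally p_infty (fun Y => Rpower Y g < eps).
Proof.
  intros Hg He. exists (Rmax 1 (Rpower eps (/ g))). intros Y HY.
  assert (H1 : Rpower eps (/ g) < Y) by (eapply Rle_lt_trans; [apply Rmax_r | exact HY]).
  assert (H2 : 1 < Y) by (eapply Rle_lt_trans; [apply Rmax_l | exact HY]).
  replace g with (- - g) by ring. rewrite Rpower_Ropp.
  replace eps with (/ / eps) by (field; lra).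
  apply Rinv_lt_contravar. apply Rmult_lt_0_compat. now apply Rinv_0_lt_compat. apply Rpower_pos.
  replace (/ eps) with (Rpower (Rpower eps (/ g)) (- g)).
  - apply Rlt_Rpower_l. lra. split. apply Rpower_pos. exact H1.
  - rewrite Rpower_mult. replace (/ g * - g) with (- (1)) by (field; lra).
    rewrite Rpower_Ropp, Rpower_1; auto.
Qed.

Lemma improper_exists (b : R) (F : R -> C) (K g : R) : 0 < b -> g < -1 -> continuous_from b F ->
  (forall y, b <= y -> Cmod (F y) <= K * Rpower y g) -> exists l, is_improper b F l.
Proof.
  intros Hb Hg HF HK.
  assert (HK0 : 0 <= K).
  { exact (bound_constant_ge_0 _ _ _ _ (HK b (Rle_refl b))). }
  apply (filterlim_locally_cauchy (U := C_R_CompleteNormedModule)). intros [eps He].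
  set (d := eps / (K + 1) * (- (g + 1)) ).
  assert (Hd : 0 < d). { unfold d. apply Rmult_lt_0_compat. apply Rdiv_lt_0_compat; lra. lra. }
  exists (fun Y => b <= Y /\ Rpower Y (g + 1) < d). split.
  { apply filter_and. apply eventually_ge. apply Rpower_lim_0; lra. }
  assert (Hm : forall u v, b <= u -> u <= v -> Rpower u (g + 1) < d ->
    Cmod (RIntC F u v) < eps).
  { intros u v Hu Huv Hud. eapply Rle_lt_trans. apply (RInt_tail_bound b F K g u v); auto.
    assert (H : Rpower u (g + 1) / - (g + 1) < eps / (K + 1)).
    { apply Rmult_lt_reg_r with (- (g + 1)). lra. unfold Rdiv at 1.
      rewrite Rmult_assoc, Rinv_l by lra.
      rewrite Rmult_1_r. exact Hud. }
    assert (H0 : eps = (K + 1) * (eps / (K + 1))) by (field; lra).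
    assert (0 < eps / (K + 1)) by (apply Rdiv_lt_0_compat; lra).
    assert (K * (Rpower u (g + 1) / - (g + 1)) <= K * (eps / (K + 1)))
      by (apply Rmult_le_compat_l; lra).
    lra. }
  assert (Hc : forall u v, b <= u -> b <= v ->
    (RIntC F b v = RIntC F b u + RIntC F u v)%C).
  { intros u v Hu Hv. symmetry.
    apply (RInt_Chasles (V := C_R_CompleteNormedModule)); apply (ex_RInt_from b); auto; lra. }
  intros u v [Hu Hud] [Hv Hvd].
  apply (norm_compat1 (V := C_R_NormedModule)). rewrite norm_C_R. simpl.
  change (Cmod (RIntC F b v - RIntC F b u)%C < eps).
  destruct (Rle_dec u v) as [H|H].
  - rewrite (Hc u v) by assumption.
    assert (R1 : forall x y : C, (x + y - x)%C = y) by (intros; ring). rewrite R1.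
    apply Hm; auto.
  - rewrite (Hc v u) by assumption.
    assert (R1 : forall x y : C, (x - (x + y))%C = (- y)%C) by (intros; ring).
    rewrite R1, Cmod_opp. apply Hm; auto. lra.
Qed.

(** [h] stands for a continuation of [F] below [b]: [F] itself may be discontinuous
    at [b] as a function on the whole line. *)
Lemma RInt_gen_improper (b : R) (h F : R -> C) (l : C) : continuous_from b h ->
  (forall y, b <= y -> h y = F y) -> is_improper b h l ->
  RIntC_gen F (at_point b) (Rbar_locally p_infty) = l.
Proof.
  intros Hh E Hl. apply (is_RInt_gen_unique (V := C_R_CompleteNormedModule)).
  intros P HP. specialize (Hl P HP).
  apply (Filter_prod _ _ _ (fun x => x = b) (fun Y => b <= Y /\ P (RIntC h b Y))).
  - reflexivity.
  - apply filter_and. apply eventually_ge. exact Hl.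
  - intros x Y -> [HY HPY]. eexists. split; [|exact HPY].
    apply (is_RInt_ext (V := C_R_NormedModule) h).
    + simpl. intros x Hx. rewrite Rmin_left, Rmax_right in Hx by assumption. apply E. lra.
    + apply (RInt_correct (V := C_R_CompleteNormedModule)). apply (ex_RInt_from b); auto.
      apply Rle_refl.
Qed.

(** * The regularized oscillatory kernels *)

Definition phase (a eps y0 y : R) : C :=
  (RtoC (exp (- eps * (y - y0) ^ 2)) * exp_i (a * y ^ 2))%C.

(** The logarithmic derivative of [phase], that is [2 (i a - eps) y + 2 eps y0]. *)
Definition rate (a eps y0 y : R) : C := (-2 * eps * (y - y0), 2 * a * y).

(** The derivative of [/ rate] is this constant times [(/ rate) ^ 2]. *)
Definition neg_rate_slope (a eps : R) : C := (2 * eps, -2 * a).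

Definition kernel (a eps y0 : R) (r : nat) (y : R) : C :=
  (phase a eps y0 y * (/ rate a eps y0 y) ^ r)%C.

Lemma is_derive_phase (a eps y0 y : R) :
  is_deriveC (phase a eps y0) y (rate a eps y0 y * phase a eps y0 y)%C.
Proof.
  apply is_derive_ext with (fun t => (exp (- eps * (t - y0) ^ 2) * cos (a * t ^ 2),
    exp (- eps * (t - y0) ^ 2) * sin (a * t ^ 2)) : C).
  - intros t. unfold phase, exp_i, Cmult, RtoC; simpl. f_equal; ring.
  - replace (rate a eps y0 y * phase a eps y0 y)%C with
     ((-2 * eps * (y - y0)) * (exp (- eps * (y - y0) ^ 2) * cos (a * y ^ 2))
       - 2 * a * y * (exp (- eps * (y - y0) ^ 2) * sin (a * y ^ 2)),
      (-2 * eps * (y - y0)) * (exp (- eps * (y - y0) ^ 2) * sin (a * y ^ 2))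
        + 2 * a * y * (exp (- eps * (y - y0) ^ 2) * cos (a * y ^ 2))).
    2: { unfold rate, phase, exp_i, Cmult, RtoC; simpl. f_equal; ring. }
    apply is_derive_C; auto_derive; auto; unfold Rminus, pow; ring.
Qed.

Lemma rate_ne_0 (a eps y0 y : R) : a <> 0 -> 0 < y -> rate a eps y0 y <> 0.
Proof.
  intros Ha Hy H. apply (f_equal snd) in H. simpl in H.
  assert (2 * a * y <> 0) by (repeat apply Rmult_integral_contrapositive_currified; lra). lra.
Qed.

Lemma is_derive_Cinv (f : R -> C) (y : R) (df : C) : f y <> 0 ->
  is_deriveC f y df ->
  is_deriveC (fun t => / f t)%C y (- df * (/ f y) ^ 2)%C.
Proof.
  intros Hn H.
  assert (H1 := is_derive_fst _ _ _ H). assert (H2 := is_derive_snd _ _ _ H).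
  set (u := fst (f y)). set (v := snd (f y)).
  set (n := u ^ 2 + v ^ 2).
  assert (Hn0 : n <> 0).
  { intros Hz. apply Hn. apply Cmod_eq_0. unfold Cmod. fold u v n. rewrite Hz. apply sqrt_0. }
  assert (H3 : is_derive (fun t => fst (f t) ^ 2 + snd (f t) ^ 2) y
    (2 * fst df * u + 2 * snd df * v)).
  { replace (2 * fst df * u + 2 * snd df * v)
      with (INR 2 * fst df * fst (f y) ^ 1 + INR 2 * snd df * snd (f y) ^ 1)
      by (unfold u, v; simpl; ring).
    apply (is_derive_plus (V := R_NormedModule)); apply is_derive_pow; assumption. }
  unfold Cinv at 1.
  replace (- df * (/ f y) ^ 2)%C with
    ((fst df * n - u * (2 * fst df * u + 2 * snd df * v)) / n ^ 2,
     (- snd df * n - - v * (2 * fst df * u + 2 * snd df * v)) / n ^ 2).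
  - apply is_derive_C.
    + exact (is_derive_div (fun t => fst (f t))
        (fun t => fst (f t) ^ 2 + snd (f t) ^ 2) y _ _ H1 H3 Hn0).
    + refine (is_derive_div (fun t => - snd (f t))
        (fun t => fst (f t) ^ 2 + snd (f t) ^ 2) y _ _ _ H3 Hn0).
      apply (is_derive_opp (V := R_NormedModule)). exact H2.
  - unfold Cinv. fold u v n.
    (* only the numerators need the value of [n]: the identity holds for any denominator *)
    replace (fst df * n) with (fst df * (u ^ 2 + v ^ 2)) by reflexivity.
    replace (- snd df * n) with (- snd df * (u ^ 2 + v ^ 2)) by reflexivity.
    destruct df as [du dv]. unfold Cpow, Cmult, Copp, RtoC, fst, snd. clearbody u v n.
    f_equal; field; exact Hn0.
Qed.

Lemma is_derive_inv_rate (a eps y0 y : R) : a <> 0 -> 0 < y ->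
  is_deriveC (fun t => / rate a eps y0 t)%C y (neg_rate_slope a eps * (/ rate a eps y0 y) ^ 2)%C.
Proof.
  intros Ha Hy. replace (neg_rate_slope a eps) with (- ((-2 * eps)%R, (2 * a)%R))%C.
  2: { unfold neg_rate_slope, Copp, fst, snd. f_equal; ring. }
  apply is_derive_Cinv. now apply rate_ne_0.
  apply is_derive_C; auto_derive; auto; ring.
Qed.

Lemma is_derive_inv_rate_pow (a eps y0 y : R) (r : nat) : a <> 0 -> 0 < y ->
  is_deriveC (fun t => (/ rate a eps y0 t) ^ r)%C y
    (INR r * neg_rate_slope a eps * (/ rate a eps y0 y) ^ (S r))%C.
Proof.
  intros Ha Hy. induction r as [|r IH].
  - assert (E : (INR 0 * neg_rate_slope a eps * (/ rate a eps y0 y) ^ 1)%C = 0)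
      by (simpl INR; ring).
    rewrite E. apply is_derive_ext with (fun _ : R => RtoC 1); [reflexivity|].
    apply (is_derive_const (V := C_R_NormedModule)).
  - apply is_derive_ext with (fun t => (/ rate a eps y0 t) * (/ rate a eps y0 t) ^ r)%C.
    { intros t. reflexivity. }
    assert (H := is_derive_Cmult _ _ _ _ _ (is_derive_inv_rate a eps y0 y Ha Hy) IH).
    match goal with |- is_derive _ _ ?d => match type of H with is_derive _ _ ?d' =>
      replace d with d'; [exact H|] end end.
    rewrite S_INR, RtoC_plus. rewrite !Cpow_S. change ((/ rate a eps y0 y) ^ 0)%C with (RtoC 1).
    ring.
Qed.

(** The identity behind the integration by parts: [rate] cancels one of the [r + 1]
    inverse powers, and differentiating those powers adds one. *)
Lemma is_derive_kernel (a eps y0 y : R) (r : nat) : a <> 0 -> 0 < y ->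
  is_deriveC (kernel a eps y0 (S r)) y
    (kernel a eps y0 r y + INR (S r) * neg_rate_slope a eps * kernel a eps y0 (S (S r)) y)%C.
Proof.
  intros Ha Hy.
  assert (H := is_derive_Cmult _ _ _ _ _ (is_derive_phase a eps y0 y)
    (is_derive_inv_rate_pow a eps y0 y (S r) Ha Hy)).
  match goal with |- is_derive _ _ ?d => match type of H with is_derive _ _ ?d' =>
    replace d with d'; [exact H|] end end.
  unfold kernel. rewrite !Cpow_S.
  set (p := rate a eps y0 y). assert (Hp : p <> 0) by (apply rate_ne_0; auto). set (q := (/ p)%C).
  assert (Hq : (p * q = 1)%C) by (apply Cinv_r; exact Hp).
  replace (p * phase a eps y0 y * (q * q ^ r))%C
    with ((p * q) * (phase a eps y0 y * q ^ r))%C by ring.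
  rewrite Hq. ring.
Qed.

Lemma continuous_kernel (a eps y0 y : R) (r : nat) : a <> 0 -> 0 < y ->
  continuousC (kernel a eps y0 r) y.
Proof.
  intros Ha Hy. apply continuous_Cmult; eapply is_derive_continuous_C.
  apply is_derive_phase. apply is_derive_inv_rate_pow; auto.
Qed.

Lemma continuous_from_kernel_mult (a b eps y0 : R) (r : nat) (h : R -> C) : a <> 0 -> 0 < b ->
  continuous_from b h -> continuous_from b (fun y => kernel a eps y0 r y * h y)%C.
Proof.
  intros Ha Hb Hh y Hy. apply continuous_Cmult; [|now apply Hh]. apply continuous_kernel; auto; lra.
Qed.

Lemma Cmod_exp_i (t : R) : Cmod (exp_i t) = 1.
Proof.
  unfold Cmod, exp_i; simpl. replace (_ + _) with 1. apply sqrt_1.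
  generalize (sin2_cos2 t); unfold Rsqr; lra.
Qed.

Lemma Cmod_phase (a eps y0 y : R) : Cmod (phase a eps y0 y) = exp (- eps * (y - y0) ^ 2).
Proof.
  unfold phase. rewrite Cmod_mult, Cmod_exp_i, Cmod_R, Rabs_pos_eq by (apply Rlt_le, exp_pos). ring.
Qed.

(** The imaginary part alone gives a bound that depends neither on [eps] nor on [y0]. *)
Lemma Cmod_rate (a eps y0 y : R) : 0 < y -> 2 * Rabs a * y <= Cmod (rate a eps y0 y).
Proof.
  intros Hy. apply Rle_trans with (Rabs (snd (rate a eps y0 y))).
  - simpl. rewrite !Rabs_mult. rewrite (Rabs_pos_eq y), (Rabs_pos_eq 2) by lra. lra.
  - eapply Rle_trans; [|apply Rmax_Cmod]. apply Rmax_r.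
Qed.

Lemma Cmod_inv_rate (a eps y0 y : R) : a <> 0 -> 0 < y ->
    Cmod (/ rate a eps y0 y) <= / (2 * Rabs a * y).
Proof.
  intros Ha Hy. rewrite Cmod_inv by (apply rate_ne_0; auto).
  pose proof (Rabs_pos_lt a Ha).
  apply Rinv_le_contravar. repeat apply Rmult_lt_0_compat; lra. now apply Cmod_rate.
Qed.

Lemma Cmod_kernel (a eps y0 y : R) (r : nat) : a <> 0 -> 0 < y ->
  Cmod (kernel a eps y0 r y) <= exp (- eps * (y - y0) ^ 2) * (/ (2 * Rabs a * y)) ^ r.
Proof.
  intros Ha Hy. unfold kernel. rewrite Cmod_mult, Cmod_phase, Cmod_pow.
  apply Rmult_le_compat_l. apply Rlt_le, exp_pos.
  apply pow_incr. split. apply Cmod_ge_0. now apply Cmod_inv_rate.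
Qed.

Lemma inv_pow_Rpower (k y : R) (r : nat) : 0 < k -> 0 < y ->
  (/ (k * y)) ^ r = (/ k) ^ r * Rpower y (- INR r).
Proof.
  intros Hk Hy. rewrite Rinv_mult, Rpow_mult_distr. f_equal.
  rewrite Rpower_Ropp, Rpower_pow by assumption. apply pow_inv.
Qed.

Lemma exp_monotone (x y : R) : x <= y -> exp x <= exp y.
Proof. intros [H | ->]; [left; now apply exp_increasing | right; reflexivity]. Qed.

(** Interpolates between a bound that is uniform and one that is small with [x]. *)
Lemma Rmin_1_le_Rpower (x theta : R) : 0 < x -> 0 <= theta <= 1 -> Rmin 1 x <= Rpower x theta.
Proof.
  intros Hx Ht. destruct (Rle_dec 1 x) as [H|H].
  - eapply Rle_trans; [apply Rmin_l|]. rewrite <- (Rpower_O x Hx). apply Rle_Rpower; lra.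
  - eapply Rle_trans; [apply Rmin_r|]. rewrite <- (Rpower_1 x Hx) at 1.
    unfold Rpower. apply exp_monotone.
    assert (ln x < 0) by (rewrite <- ln_1; apply ln_increasing; lra). nra.
Qed.

(** Both phases have the same argument; with [s = eps (y - y0)^2], their moduli differ by
    [1 - exp (- s)], which is at most [1] and at most [s]. *)
Lemma phase_diff (a eps y0 y B : R) : 0 < eps -> 1 <= B -> Rabs (y - y0) <= B * y -> 0 < y ->
  Cmod (phase a eps y0 y - phase a 0 0 y) <= B ^ 2 * Rmin 1 (eps * y ^ 2).
Proof.
  intros He HB Hy0 Hy.
  replace (phase a eps y0 y - phase a 0 0 y)%C
    with (RtoC (exp (- eps * (y - y0) ^ 2) - 1) * exp_i (a * y ^ 2))%C.
  2: { unfold phase. replace (- 0 * (y - 0) ^ 2) with 0 by ring. rewrite exp_0, RtoC_minus. ring. }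
  rewrite Cmod_mult, Cmod_exp_i, Rmult_1_r, Cmod_R.
  set (s := eps * (y - y0) ^ 2).
  assert (Hs : 0 <= s) by (apply Rmult_le_pos; [lra | apply pow2_ge_0]).
  replace (- eps * (y - y0) ^ 2) with (- s) by (unfold s; ring).
  assert (H1 : exp (- s) <= 1) by (rewrite <- exp_0; apply exp_monotone; lra).
  assert (H2 : 1 + - s <= exp (- s)) by apply exp_ineq1_le.
  pose proof (exp_pos (- s)).
  rewrite Rabs_left1 by lra.
  assert (HB2 : 1 <= B ^ 2) by nra.
  assert (Hsx : s <= B ^ 2 * (eps * y ^ 2)).
  { unfold s. replace (B ^ 2 * (eps * y ^ 2)) with (eps * (B * y) ^ 2) by ring.
    apply Rmult_le_compat_l; [lra|]. rewrite <- (pow2_abs (y - y0)). apply pow_incr.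
    split; [apply Rabs_pos | exact Hy0]. }
  unfold Rmin; destruct Rle_dec; lra.
Qed.

(** The [1] in the minimum is the triangle inequality; the [eps * y ^ 2] comes from
    [1 / p1 - 1 / p2 = (p2 - p1) / (p1 p2)], after enlarging [eps] to
    [eps * y ^ 2 / b ^ 2]. *)
Lemma inv_rate_diff (a eps y0 y b B : R) : a <> 0 -> 0 < eps -> 0 < b <= y -> 0 <= B ->
    Rabs (y - y0) <= B * y ->
  Cmod (/ rate a eps y0 y - / rate a 0 0 y)
    <= (2 + B / (Rabs a * b ^ 2)) * Rmin 1 (eps * y ^ 2) * / (2 * Rabs a * y).
Proof.
  intros Ha He [Hb Hy] HB Hy0.
  assert (Hy' : 0 < y) by lra. pose proof (Rabs_pos_lt a Ha) as HA.
  pose proof (Cmod_inv_rate a eps y0 y Ha Hy') as I1.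
  pose proof (Cmod_inv_rate a 0 0 y Ha Hy') as I2.
  set (w := / (2 * Rabs a * y)) in *.
  assert (Hw : 0 < w). { apply Rinv_0_lt_compat. repeat apply Rmult_lt_0_compat; lra. }
  assert (HK : 0 <= B / (Rabs a * b ^ 2)).
  { apply Rdiv_le_0_compat; auto. apply Rmult_lt_0_compat; auto. apply pow_lt; auto. }
  unfold Rmin. destruct Rle_dec as [Hx|Hx].
  - rewrite Rmult_1_r. eapply Rle_trans; [apply Cmod_triangle|]. rewrite Cmod_opp. nra.
  - assert (E : (/ rate a eps y0 y - / rate a 0 0 y
    = RtoC (2 * eps * (y - y0)) * (/ rate a eps y0 y * / rate a 0 0 y))%C).
    { assert (Hr : RtoC (2 * eps * (y - y0)) = (rate a 0 0 y - rate a eps y0 y)%C).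
      { unfold rate, RtoC, Cminus, Cplus, Copp; simpl. f_equal; ring. }
      rewrite Hr. field. split; apply rate_ne_0; auto. }
    rewrite E, !Cmod_mult, Cmod_R, !Rabs_mult, (Rabs_pos_eq 2), (Rabs_pos_eq eps) by lra.
    apply Rle_trans with (2 * eps * (B * y) * (w * w)).
    { apply Rmult_le_compat.
      - repeat apply Rmult_le_pos; try lra. apply Rabs_pos.
      - apply Rmult_le_pos; apply Cmod_ge_0.
      - apply Rmult_le_compat_l; lra.
      - apply Rmult_le_compat; auto using Cmod_ge_0. }
    rewrite <- Rmult_assoc. apply Rmult_le_compat_r; [lra|].
    replace (2 * eps * (B * y) * w) with (eps * (B / Rabs a)) by (unfold w; field; lra).
    apply Rle_trans with ((B / (Rabs a * b ^ 2)) * (eps * y ^ 2)).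
    + replace (eps * (B / Rabs a)) with (B / (Rabs a * b ^ 2) * (eps * b ^ 2)) by (field; lra).
      apply Rmult_le_compat_l; auto. apply Rmult_le_compat_l; [lra|]. apply pow_incr. lra.
    + apply Rmult_le_compat_r. apply Rmult_le_pos; [lra | apply pow2_ge_0]. lra.
Qed.

Lemma Cpow_diff (p q : C) (w d : R) (r : nat) : Cmod p <= w -> Cmod q <= w ->
    Cmod (p - q) <= d * w ->
  Cmod (p ^ r - q ^ r) <= INR r * d * w ^ r.
Proof.
  intros Hp Hq Hd. induction r as [|r IH].
  - simpl INR. change (p ^ 0)%C with (RtoC 1). change (q ^ 0)%C with (RtoC 1).
    replace (RtoC 1 - RtoC 1)%C with (RtoC 0) by ring. rewrite Cmod_0. lra.
  - rewrite S_INR. rewrite !Cpow_S.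
    replace (p * p ^ r - q * q ^ r)%C with (p * (p ^ r - q ^ r) + (p - q) * q ^ r)%C by ring.
    eapply Rle_trans; [apply Cmod_triangle|]. rewrite !Cmod_mult, Cmod_pow.
    assert (Cmod q ^ r <= w ^ r) by (apply pow_incr; split; auto using Cmod_ge_0).
    replace ((INR r + 1) * d * w ^ S r) with (w * (INR r * d * w ^ r) + d * w * w ^ r)
      by (simpl; ring).
    apply Rplus_le_compat; apply Rmult_le_compat; auto using Cmod_ge_0, pow_le.
Qed.

(** Convergence of the kernels as [eps -> 0], at the price of a factor [y^(2 theta)].
    It replaces a dominated convergence argument by an explicit estimate. *)
Lemma kernel_diff (a b y0 : R) (r : nat) : a <> 0 -> 0 < b ->
  exists K, 0 <= K /\ forall eps y theta, 0 < eps -> b <= y -> 0 <= theta <= 1 ->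
    Cmod (kernel a eps y0 r y - kernel a 0 0 r y)
      <= K * Rpower eps theta * Rpower y (2 * theta - INR r).
Proof.
  intros Ha Hb. pose proof (Rabs_pos_lt a Ha) as HA.
  (* on the half-line, [|y - y0| <= B y] *)
  set (B := 1 + Rabs y0 / b).
  assert (HB0 : 0 <= Rabs y0 / b) by (apply Rdiv_le_0_compat; auto; apply Rabs_pos).
  assert (HB : 1 <= B) by (unfold B; lra).
  set (K1 := 2 + B / (Rabs a * b ^ 2)).
  assert (HK1 : 0 <= K1).
  { unfold K1. assert (0 <= B / (Rabs a * b ^ 2)); [|lra].
    apply Rdiv_le_0_compat. lra. apply Rmult_lt_0_compat; auto. apply pow_lt; auto. }
  pose proof (pos_INR r).
  assert (HC : 0 <= INR r * K1 + B ^ 2).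
  { apply Rplus_le_le_0_compat. now apply Rmult_le_pos. apply pow2_ge_0. }
  exists ((INR r * K1 + B ^ 2) * (/ (2 * Rabs a)) ^ r). split.
  { apply Rmult_le_pos; auto. apply pow_le. left. apply Rinv_0_lt_compat. lra. }
  intros eps y theta He Hy Ht.
  assert (Hy' : 0 < y) by lra.
  assert (Hyy0 : Rabs (y - y0) <= B * y).
  { eapply Rle_trans; [apply Rabs_triang|]. rewrite Rabs_Ropp, (Rabs_pos_eq y) by lra.
    unfold B. replace (Rabs y0) with (Rabs y0 / b * b) at 1 by (field; lra). nra. }
  set (m := Rmin 1 (eps * y ^ 2)).
  assert (Hx : 0 < eps * y ^ 2) by (apply Rmult_lt_0_compat; [|apply pow_lt]; lra).
  assert (Hm : 0 < m) by (unfold m; apply Rmin_pos; lra).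
  set (w := / (2 * Rabs a * y)).
  assert (Hd : Cmod (kernel a eps y0 r y - kernel a 0 0 r y) <= (INR r * K1 + B ^ 2) * m * w ^ r).
  { unfold kernel.
    set (p := (/ rate a eps y0 y)%C). set (q := (/ rate a 0 0 y)%C).
    assert (Hp : Cmod p <= w) by (apply Cmod_inv_rate; auto).
    assert (Hq : Cmod q <= w) by (apply Cmod_inv_rate; auto).
    assert (Hpq : Cmod (p - q) <= (K1 * m) * w) by (apply inv_rate_diff; auto; lra).
    replace (phase a eps y0 y * p ^ r - phase a 0 0 y * q ^ r)%C with
      (phase a eps y0 y * (p ^ r - q ^ r) + (phase a eps y0 y - phase a 0 0 y) * q ^ r)%C by ring.
    eapply Rle_trans; [apply Cmod_triangle|]. rewrite !Cmod_mult, Cmod_phase, Cmod_pow.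
    replace ((INR r * K1 + B ^ 2) * m * w ^ r)
      with (1 * (INR r * (K1 * m) * w ^ r) + (B ^ 2 * m) * w ^ r) by ring.
    apply Rplus_le_compat; apply Rmult_le_compat; auto using Cmod_ge_0, pow_le.
    - apply Rlt_le, exp_pos.
    - rewrite <- exp_0. apply exp_monotone. pose proof (pow2_ge_0 (y - y0)). nra.
    - now apply Cpow_diff.
    - now apply phase_diff.
    - apply pow_incr. split; auto using Cmod_ge_0. }
  eapply Rle_trans; [exact Hd|]. unfold w. rewrite inv_pow_Rpower by lra.
  replace (2 * theta - INR r) with (theta + theta + - INR r) by ring.
  rewrite !Rpower_plus.
  assert (Hmx : m <= Rpower eps theta * (Rpower y theta * Rpower y theta)).
  { unfold m. eapply Rle_trans. apply Rmin_1_le_Rpower; eauto.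
    replace (y ^ 2) with (y * y) by ring. rewrite <- !Rpower_mult_distr; try nra. }
  set (u := (/ (2 * Rabs a)) ^ r).
  assert (Hu : 0 <= u). { apply pow_le. left. apply Rinv_0_lt_compat. lra. }
  set (v := Rpower y (- INR r)). assert (Hv : 0 < v) by apply Rpower_pos.
  replace ((INR r * K1 + B ^ 2) * u * Rpower eps theta * (Rpower y theta * Rpower y theta * v)) with
   ((INR r * K1 + B ^ 2) * (Rpower eps theta * (Rpower y theta * Rpower y theta)) * (u * v))
    by ring.
  apply Rmult_le_compat_r. apply Rmult_le_pos; lra. now apply Rmult_le_compat_l.
Qed.

(** Far out, [(y - y0)^2 >= y^2 / 4] and [ln y <= y], so the exponent of the product
    is below [- y]. *)
Lemma gaussian_decay (eps y0 g d : R) : 0 < eps -> 0 < d ->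
  Rbar_locally p_infty (fun y => exp (- eps * (y - y0) ^ 2) * Rpower y g < d).
Proof.
  intros He Hd.
  exists (Rmax (Rmax 1 (2 * Rabs y0)) (Rmax (4 * (Rabs g + 1) / eps) (- ln d))).
  intros y Hy.
  pose proof (Rmax_l (Rmax 1 (2 * Rabs y0)) (Rmax (4 * (Rabs g + 1) / eps) (- ln d))).
  pose proof (Rmax_r (Rmax 1 (2 * Rabs y0)) (Rmax (4 * (Rabs g + 1) / eps) (- ln d))).
  pose proof (Rmax_l 1 (2 * Rabs y0)). pose proof (Rmax_r 1 (2 * Rabs y0)).
  pose proof (Rmax_l (4 * (Rabs g + 1) / eps) (- ln d)).
  pose proof (Rmax_r (4 * (Rabs g + 1) / eps) (- ln d)).
  unfold Rpower. rewrite <- exp_plus.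
  apply Rlt_le_trans with (exp (ln d)); [|rewrite exp_ln; lra].
  apply exp_increasing.
  assert (H5 : 4 * (Rabs g + 1) < eps * y).
  { apply Rmult_lt_reg_r with (/ eps). now apply Rinv_0_lt_compat.
    replace (eps * y * / eps) with y by (field; lra). unfold Rdiv in *. lra. }
  assert (H6 : 0 <= ln y). { rewrite <- ln_1. apply Rcomplements.ln_le; lra. }
  assert (H7 : ln y <= y). { apply Rle_trans with (y - 1); [|lra].
    pose proof (exp_ineq1_le (ln y)) as H7. rewrite exp_ln in H7 by lra. lra. }
  assert (H8 : g * ln y <= Rabs g * y).
  { apply Rle_trans with (Rabs g * ln y). apply Rmult_le_compat_r; auto. apply Rle_abs.
    apply Rmult_le_compat_l; auto. apply Rabs_pos. }
  assert (H9 : y / 2 <= y - y0). { pose proof (Rle_abs y0). lra. }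
  assert (H10 : (y / 2) ^ 2 <= (y - y0) ^ 2) by (apply pow_incr; lra).
  assert (H11 : eps * (y / 2) ^ 2 <= eps * (y - y0) ^ 2) by (apply Rmult_le_compat_l; lra).
  nra.
Qed.

(** * Integration by parts down to an absolutely convergent integral *)

(** A function [H 0] together with its derivatives [H k], each of which loses one power
    of growth. *)
Definition jet (b : R) (N : nat) (beta M : R) (H : nat -> R -> C) : Prop :=
  (forall k y, (k < N)%nat -> b <= y -> is_deriveC (H k) y (H (S k) y)) /\
  continuous_from b (H N) /\
  (forall k y, (k <= N)%nat -> b <= y -> Cmod (H k y) <= M * Rpower y (beta - INR k)).

Lemma jet_continuous (b : R) (N : nat) (beta M : R) (H : nat -> R -> C) (k : nat) :
  jet b N beta M H -> (k <= N)%nat -> continuous_from b (H k).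
Proof.
  intros (Hd & Hc & _) Hk y Hy. destruct (Nat.eq_dec k N) as [->|Hne]; [now apply Hc|].
  eapply is_derive_continuous_C. apply Hd; auto; lia.
Qed.

Lemma jet_shift (b : R) (N : nat) (beta M : R) (H : nat -> R -> C) :
  jet b (S N) beta M H -> jet b N (beta - 1) M (fun k => H (S k)).
Proof.
  intros (Hd & Hc & Hb). split; [|split].
  - intros k y Hk Hy. apply Hd; auto; lia.
  - exact Hc.
  - intros k y Hk Hy. replace (beta - 1 - INR k) with (beta - INR (S k)) by (rewrite S_INR; ring).
    apply Hb; auto; lia.
Qed.

Lemma jet_truncate (b : R) (N : nat) (beta M : R) (H : nat -> R -> C) :
  jet b (S N) beta M H -> jet b N beta M H.
Proof.
  intros HJ. assert (HJ' := HJ). destruct HJ' as (Hd & Hc & Hb). split; [|split].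
  - intros k y Hk Hy. apply Hd; auto; lia.
  - apply (jet_continuous b (S N) beta M); auto.
  - intros k y Hk Hy. apply Hb; auto; lia.
Qed.

Lemma filterlim_at_right_Rpower_bound (J : R -> C) (l : C) (K theta : R) : 0 < theta ->
  (forall eps, 0 < eps -> Cmod (J eps - l) <= K * Rpower eps theta) ->
  filterlim J (at_right 0) (locally l).
Proof.
  intros Ht HJ. apply filterlim_C. apply at_right_proper_filter. intros d Hd.
  set (e := d / (Rabs K + 1)). assert (HK : 0 < Rabs K + 1) by (pose proof (Rabs_pos K); lra).
  assert (He : 0 < e) by (apply Rdiv_lt_0_compat; auto).
  exists (mkposreal _ (Rpower_pos e (/ theta))). intros eps Hb Hpos.
  change (Rabs (eps - 0) < Rpower e (/ theta)) in Hb.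
  rewrite Rminus_0_r, Rabs_pos_eq in Hb by lra.
  assert (H1 : Rpower eps theta < e).
  { replace e with (Rpower (Rpower e (/ theta)) theta).
    - apply Rlt_Rpower_l; auto.
    - rewrite Rpower_mult, Rinv_l, Rpower_1; auto; lra. }
  eapply Rle_lt_trans; [now apply HJ|].
  pose proof (Rpower_pos eps theta). pose proof (Rle_abs K).
  apply Rle_lt_trans with ((Rabs K + 1) * Rpower eps theta).
  - apply Rmult_le_compat_r; lra.
  - replace d with ((Rabs K + 1) * e) by (unfold e; field; lra). now apply Rmult_lt_compat_l.
Qed.

(** One limit [l] for all [y0].  The values [J eps] are given as limits of integrals
    over [[b, Y]], so that they are known to exist. *)
Definition is_kernel_limit (a b : R) (r : nat) (h : R -> C) (l : C) : Prop :=
  forall y0, exists J : R -> C,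
    (forall eps, 0 < eps -> is_improper b (fun y => kernel a eps y0 r y * h y)%C (J eps)) /\
    filterlim J (at_right 0) (locally l).

(** With [s = r - g - 1 > 0] the exponent to spare, [theta <= s / 4] makes
    [y^(2 theta + g - r)] integrable, and the estimate [kernel_diff] integrates to a
    multiple of [eps^theta]. *)
Lemma kernel_limit_absolute (a b : R) (r : nat) (g : R) : a <> 0 -> 0 < b -> g - INR r < -1 ->
  exists A, forall (h : R -> C) (M : R), continuous_from b h ->
    (forall y, b <= y -> Cmod (h y) <= M * Rpower y g) ->
    exists l, Cmod l <= A * M /\ is_kernel_limit a b r h l.
Proof.
  intros Ha Hb Hg. pose proof (Rabs_pos_lt a Ha) as HA.
  set (w := (/ (2 * Rabs a)) ^ r).
  assert (Hw : 0 < w). { apply pow_lt. apply Rinv_0_lt_compat. lra. }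
  exists (w * (Rpower b (g - INR r + 1) / - (g - INR r + 1))).
  intros h M Hc HM.
  assert (HM0 : 0 <= M).
  { exact (bound_constant_ge_0 _ _ _ _ (HM b (Rle_refl b))). }
  assert (HF : forall eps y0, continuous_from b (fun y => kernel a eps y0 r y * h y)%C).
  { intros. now apply continuous_from_kernel_mult. }
  assert (HB : forall eps y0, 0 <= eps -> forall y, b <= y ->
    Cmod (kernel a eps y0 r y * h y) <= (w * M) * Rpower y (g - INR r)).
  { intros eps y0 He y Hy. rewrite Cmod_mult. unfold Rminus at 1. rewrite Rpower_plus.
    replace (w * M * (Rpower y g * Rpower y (- INR r)))
      with ((w * Rpower y (- INR r)) * (M * Rpower y g)) by ring.
    apply Rmult_le_compat; auto using Cmod_ge_0.
    eapply Rle_trans; [apply Cmod_kernel; auto; lra|]. rewrite inv_pow_Rpower by lra. fold w.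
    rewrite <- (Rmult_1_l (w * _)) at 2. apply Rmult_le_compat_r.
    - apply Rmult_le_pos. lra. apply Rlt_le, Rpower_pos.
    - rewrite <- exp_0. apply exp_monotone. pose proof (pow2_ge_0 (y - y0)). nra. }
  destruct (improper_exists b _ _ _ Hb Hg (HF 0 0) (HB 0 0 (Rle_refl 0))) as [l Hl].
  exists l. split.
  { eapply Rle_trans; [exact (improper_bound b _ _ _ _ Hb Hg (HF 0 0) (HB 0 0 (Rle_refl 0)) Hl)|].
    right. ring. }
  intros y0.
  exists (fun eps => RIntC_gen (fun y => kernel a eps y0 r y * h y)%C (at_point b)
    (Rbar_locally p_infty)).
  assert (HJ : forall eps, 0 < eps -> is_improper b (fun y => kernel a eps y0 r y * h y)%C
    (RIntC_gen (fun y => kernel a eps y0 r y * h y)%C (at_point b) (Rbar_locally p_infty))).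
  { intros eps He. destruct (improper_exists b _ _ _ Hb Hg (HF eps y0)
    (HB eps y0 (Rlt_le _ _ He))) as [m Hm].
    rewrite (RInt_gen_improper b _ _ m (HF eps y0) (fun _ _ => eq_refl) Hm); auto. }
  split; [exact HJ|].
  destruct (kernel_diff a b y0 r Ha Hb) as (K & HK & HKd).
  set (s := - (1 + (g - INR r))). assert (Hs : 0 < s) by (unfold s; lra).
  set (theta := Rmin 1 (s / 4)).
  assert (Ht : 0 < theta <= 1). { unfold theta. split. apply Rmin_pos; lra. apply Rmin_l. }
  assert (Ht2 : theta <= s / 4) by apply Rmin_r.
  set (g' := 2 * theta + (g - INR r)). assert (Hg' : g' < -1) by (unfold g', s in *; lra).
  apply filterlim_at_right_Rpower_bound
    with (K := K * M * (Rpower b (g' + 1) / - (g' + 1))) (theta := theta); [lra|].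
  intros eps He.
  replace (K * M * (Rpower b (g' + 1) / - (g' + 1)) * Rpower eps theta) with
    ((K * M * Rpower eps theta) * (Rpower b (g' + 1) / - (g' + 1))) by ring.
  apply (improper_bound b (fun y => kernel a eps y0 r y * h y
    + - (1) * (kernel a 0 0 r y * h y))%C); auto.
  - intros y Hy. apply (continuous_plus (V := C_R_NormedModule)). now apply HF.
    apply continuous_Cmult. apply continuous_const. now apply HF.
  - intros y Hy.
    replace (kernel a eps y0 r y * h y + - (1) * (kernel a 0 0 r y * h y))%C with
      ((kernel a eps y0 r y - kernel a 0 0 r y) * h y)%C by ring.
    rewrite Cmod_mult. unfold g'. replace (2 * theta + (g - INR r))
      with ((2 * theta - INR r) + g) by ring.
    rewrite Rpower_plus.
    replace (K * M * Rpower eps theta * (Rpower y (2 * theta - INR r) * Rpower y g)) with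
      ((K * Rpower eps theta * Rpower y (2 * theta - INR r)) * (M * Rpower y g)) by ring.
    apply Rmult_le_compat; auto using Cmod_ge_0. apply HKd; auto; lra.
  - replace (RIntC_gen (fun y => kernel a eps y0 r y * h y)%C (at_point b)
    (Rbar_locally p_infty) - l)%C with
      (RIntC_gen (fun y => kernel a eps y0 r y * h y)%C (at_point b) (Rbar_locally p_infty) +
        - (1) * l)%C.
    2: { set (z := RInt_gen _ _ _). change (z + - (1) * l = z - l :> C)%C. ring. }
    apply improper_plus; auto.
    + intros y Hy. apply continuous_Cmult. apply continuous_const. now apply HF.
    + apply improper_Cmult; auto.
Qed.

Lemma filterlim_neg_rate_slope (a : R) : filterlim (neg_rate_slope a) (at_right 0)
    (locally (neg_rate_slope a 0)).
Proof.
  apply filterlim_at_right_Rpower_bound with (K := 2) (theta := 1). lra.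
  intros eps He. rewrite Rpower_1 by assumption.
  replace (neg_rate_slope a eps - neg_rate_slope a 0)%C with (RtoC (2 * eps)).
  - rewrite Cmod_R, Rabs_pos_eq; lra.
  - unfold neg_rate_slope, RtoC, Cminus, Cplus, Copp; simpl. f_equal; ring.
Qed.

Lemma filterlim_kernel (a b y0 : R) (r : nat) : a <> 0 -> 0 < b ->
  filterlim (fun eps => kernel a eps y0 r b) (at_right 0) (locally (kernel a 0 0 r b)).
Proof.
  intros Ha Hb. destruct (kernel_diff a b y0 r Ha Hb) as (K & HK & HKd).
  apply filterlim_at_right_Rpower_bound with (K := K * Rpower b (2 * 1 - INR r)) (theta := 1). lra.
  intros eps He. eapply Rle_trans; [apply (HKd eps b 1); lra|]. right. ring.
Qed.

(** The polynomial bound on [h] serves to kill the boundary term at infinity for every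
    fixed [eps > 0]. *)
Lemma kernel_limit_by_parts (a b M beta : R) (r : nat) (h dh : R -> C) (l1 l2 : C) : a <> 0 ->
    0 < b ->
  (forall y, b <= y -> is_deriveC h y (dh y)) -> continuous_from b dh ->
  (forall y, b <= y -> Cmod (h y) <= M * Rpower y beta) ->
  is_kernel_limit a b (S r) dh l1 -> is_kernel_limit a b (S (S r)) h l2 ->
  is_kernel_limit a b r h (- (kernel a 0 0 (S r) b * h b) + (- (1) * l1 +
    - (INR (S r) * neg_rate_slope a 0) * l2))%C.
Proof.
  intros Ha Hb Hd Hcd HM H1 H2 y0.
  assert (Hc : continuous_from b h). { intros y Hy. eapply is_derive_continuous_C. now apply Hd. }
  destruct (H1 y0) as (J1 & HJ1 & L1). destruct (H2 y0) as (J2 & HJ2 & L2).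
  assert (HF : forall eps r f, continuous_from b f ->
    continuous_from b (fun y => kernel a eps y0 r y * f y)%C).
  { intros. now apply continuous_from_kernel_mult. }
  assert (HFc : forall c F, continuous_from b F -> continuous_from b (fun y => c * F y)%C).
  { intros c F HFF y Hy. apply continuous_Cmult; [|now apply HFF]. apply continuous_const. }
  assert (HFp : forall F G, continuous_from b F -> continuous_from b G ->
    continuous_from b (fun y => F y + G y)%C).
  { intros F G HFF HG y Hy. apply (continuous_plus (V := C_R_NormedModule)); auto. }
  assert (HM0 : 0 <= M).
  { exact (bound_constant_ge_0 _ _ _ _ (HM b (Rle_refl b))). }
  exists (fun eps => - (kernel a eps y0 (S r) b * h b) + (- (1) * J1 eps +
    - (INR (S r) * neg_rate_slope a eps) * J2 eps))%C.
  split.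
  - intros eps He.
    (* the derivative of [W_(r+1) h], minus the two integrals that remain *)
    apply improper_ext with (F := (fun y =>
      ((kernel a eps y0 r y
          + INR (S r) * neg_rate_slope a eps * kernel a eps y0 (S (S r)) y) * h y
        + kernel a eps y0 (S r) y * dh y)
       + (- (1) * (kernel a eps y0 (S r) y * dh y) +
         - (INR (S r) * neg_rate_slope a eps) * (kernel a eps y0 (S (S r)) y * h y)))%C).
    { intros y Hy. ring. }
    assert (Hk : continuous_from b (fun y => (kernel a eps y0 r y
      + INR (S r) * neg_rate_slope a eps * kernel a eps y0 (S (S r)) y) * h y
        + kernel a eps y0 (S r) y * dh y)%C).
    { apply (HFp (fun y => (kernel a eps y0 r y
      + INR (S r) * neg_rate_slope a eps * kernel a eps y0 (S (S r)) y) * h y)%C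
        (fun y => kernel a eps y0 (S r) y * dh y)%C); auto.
      intros y Hy. apply continuous_Cmult; [|now apply Hc].
      apply (continuous_plus (V := C_R_NormedModule)).
      apply continuous_kernel; auto; lra. apply continuous_Cmult. apply continuous_const.
      apply continuous_kernel; auto; lra. }
    apply improper_plus; auto.
    + apply (improper_derive b _ (fun y => kernel a eps y0 (S r) y * h y)%C); auto.
      * intros y Hy. apply is_derive_Cmult; auto. apply is_derive_kernel; auto; lra.
      * apply filterlim_C. apply Rbar_locally_filter. intros d Hdp.
        set (w := (/ (2 * Rabs a)) ^ (S r)).
        pose proof (Rabs_pos_lt a Ha) as HA.
        assert (Hw : 0 < w). { apply pow_lt. apply Rinv_0_lt_compat. lra. }
        assert (Hd' : 0 < d / (w * M + 1)). { apply Rdiv_lt_0_compat; auto. nra. }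
        generalize (filter_and _ _ (eventually_ge b)
          (gaussian_decay eps y0 (- INR (S r) + beta) _ He Hd')).
        apply filter_imp. intros y [Hy Hg].
        replace (kernel a eps y0 (S r) y * h y - 0)%C
          with (kernel a eps y0 (S r) y * h y)%C by ring.
        rewrite Cmod_mult. rewrite Rpower_plus in Hg.
        set (E := exp (- eps * (y - y0) ^ 2)) in *.
        set (P := Rpower y (- INR (S r))) in *. set (Q := Rpower y beta) in *.
        assert (HE : 0 < E) by apply exp_pos. assert (HP : 0 < P) by apply Rpower_pos.
        assert (HQ : 0 < Q) by apply Rpower_pos.
        apply Rle_lt_trans with ((E * (w * P)) * (M * Q)).
        { apply Rmult_le_compat; auto using Cmod_ge_0.
          eapply Rle_trans; [apply Cmod_kernel; auto; lra|]. rewrite inv_pow_Rpower by lra.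
          apply Rle_refl. }
        replace (E * (w * P) * (M * Q)) with ((w * M) * (E * (P * Q))) by ring.
        assert (HwM : 0 <= w * M) by (apply Rmult_le_pos; lra).
        apply Rle_lt_trans with ((w * M) * (d / (w * M + 1))).
        { apply Rmult_le_compat_l; lra. }
        replace d with ((w * M + 1) * (d / (w * M + 1))) at 2 by (field; lra).
        apply Rmult_lt_compat_r; lra.
    + apply improper_plus; auto.
      * apply improper_Cmult; auto.
      * apply improper_Cmult; auto.
  - apply (filterlim_Cplus (at_right 0)).
    { apply (filterlim_Copp (at_right 0)). apply (filterlim_Cmult (at_right 0)).
      now apply filterlim_kernel. apply filterlim_const. }
    apply (filterlim_Cplus (at_right 0)).
    { apply (filterlim_Cmult (at_right 0)); auto. apply filterlim_const. }
    apply (filterlim_Cmult (at_right 0)); auto. apply (filterlim_Copp (at_right 0)).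
    apply (filterlim_Cmult (at_right 0)). apply filterlim_const. apply filterlim_neg_rate_slope.
Qed.

(** Induction on the number of integrations by parts.  Both new integrals use up two
    units: [h'] with [W_(r+1)] lowers [beta] and raises [r] by one, and [h] with
    [W_(r+2)] raises [r] by two. *)
Lemma kernel_limit_jet (a b : R) : a <> 0 -> 0 < b -> forall (N r : nat) (beta : R),
  beta - INR r - 2 * INR N < -1 ->
  exists A, forall (H : nat -> R -> C) (M : R), jet b N beta M H ->
    exists l, Cmod l <= A * M /\ is_kernel_limit a b r (H 0%nat) l.
Proof.
  intros Ha Hb. induction N as [|N IH]; intros r beta Hbeta.
  - destruct (kernel_limit_absolute a b r beta Ha Hb) as [A HA]. { simpl in Hbeta. lra. }
    exists A. intros H M HJ. apply HA.
    + now apply (jet_continuous b 0 beta M).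
    + intros y Hy. destruct HJ as (_ & _ & HJ). specialize (HJ 0%nat y (le_n _) Hy).
      now rewrite Rminus_0_r in HJ.
  - rewrite S_INR in Hbeta.
    destruct (IH (S r) (beta - 1)) as [A1 HA1]. { rewrite S_INR. lra. }
    destruct (IH (S (S r)) beta) as [A2 HA2]. { rewrite 2!S_INR. lra. }
    exists (Cmod (kernel a 0 0 (S r) b) * Rpower b beta + (A1
      + Cmod (INR (S r) * neg_rate_slope a 0) * A2)).
    intros H M HJ.
    destruct (HA1 _ _ (jet_shift _ _ _ _ _ HJ)) as (l1 & B1 & O1).
    destruct (HA2 _ _ (jet_truncate _ _ _ _ _ HJ)) as (l2 & B2 & O2).
    assert (HM : forall y, b <= y -> Cmod (H 0%nat y) <= M * Rpower y beta).
    { intros y Hy. destruct HJ as (_ & _ & HJ). specialize (HJ 0%nat y (Nat.le_0_l _) Hy).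
      now rewrite Rminus_0_r in HJ. }
    eexists. split; [|apply (kernel_limit_by_parts a b M beta r (H 0%nat) (H 1%nat) l1 l2); auto].
    + eapply Rle_trans; [apply Cmod_triangle|]. rewrite Cmod_opp, Cmod_mult.
      assert (Hl : Cmod (- (1) * l1 + - (INR (S r) * neg_rate_slope a 0) * l2)
        <= Cmod l1 + Cmod (INR (S r) * neg_rate_slope a 0) * Cmod l2).
      { eapply Rle_trans; [apply Cmod_triangle|]. rewrite 2!Cmod_mult, Cmod_m1, Cmod_opp. lra. }
      set (c := Cmod (INR (S r) * neg_rate_slope a 0)) in *.
      set (k := Cmod (kernel a 0 0 (S r) b)) in *.
      assert (0 <= c) by apply Cmod_ge_0. assert (0 <= k) by apply Cmod_ge_0.
      assert (k * Cmod (H 0%nat b) <= k * (M * Rpower b beta)) by (apply Rmult_le_compat_l; auto;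
        apply HM; lra).
      assert (c * Cmod l2 <= c * (A2 * M)) by (apply Rmult_le_compat_l; auto).
      lra.
    + intros y Hy. apply HJ; auto; lia.
    + apply (jet_continuous b (S N) beta M); auto; lia.
Qed.

(** * Continuity of the oscillatory integral *)

Lemma kernel_limit_ext (a b : R) (r : nat) (h g : R -> C) (l : C) : (forall y, b <= y ->
    h y = g y) ->
  is_kernel_limit a b r h l -> is_kernel_limit a b r g l.
Proof.
  intros E O y0. destruct (O y0) as (J & HJ & L). exists J. split; [|exact L].
  intros eps He. eapply improper_ext; [|now apply HJ]. intros y Hy. simpl. now rewrite E.
Qed.

Lemma kernel_limit_minus (a b : R) (r : nat) (h g : R -> C) (l m : C) : a <> 0 -> 0 < b ->
  continuous_from b h -> continuous_from b g ->
  is_kernel_limit a b r h l -> is_kernel_limit a b r g m ->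
    is_kernel_limit a b r (fun y => h y - g y)%C (l - m)%C.
Proof.
  intros Ha Hb Hh Hg O1 O2 y0. destruct (O1 y0) as (J1 & HJ1 & L1).
  destruct (O2 y0) as (J2 & HJ2 & L2).
  assert (HF : forall eps f, continuous_from b f ->
    continuous_from b (fun y => kernel a eps y0 r y * f y)%C).
  { intros. now apply continuous_from_kernel_mult. }
  exists (fun eps => J1 eps + - (1) * J2 eps)%C. split.
  - intros eps He.
    apply improper_ext with (F := (fun y => kernel a eps y0 r y * h y +
      - (1) * (kernel a eps y0 r y * g y))%C).
    { intros y Hy. ring. }
    apply improper_plus; auto.
    + intros y Hy. apply continuous_Cmult. apply continuous_const. now apply HF.
    + apply improper_Cmult; auto.
  - replace (l - m)%C with (l + - (1) * m)%C by ring.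
    apply (filterlim_Cplus (at_right 0)); auto. apply (filterlim_Cmult (at_right 0)); auto.
    apply filterlim_const.
Qed.

Lemma kernel_limit_unique (a b : R) (r : nat) (h : R -> C) (l m : C) :
  is_kernel_limit a b r h l -> is_kernel_limit a b r h m -> l = m.
Proof.
  intros O1 O2. destruct (O1 0) as (J1 & HJ1 & L1). destruct (O2 0) as (J2 & HJ2 & L2).
  apply (filterlim_locally_unique (V := C_R_NormedModule) J1 l m L1).
  eapply filterlim_ext_loc; [|exact L2].
  exists (mkposreal 1 Rlt_0_1). intros eps _ He.
  eapply improper_unique; [now apply HJ2 | now apply HJ1].
Qed.

Lemma kernel_limit_is_oscillatory_integral (a b : R) (h f : R -> C) (l : C) : a <> 0 -> 0 < b ->
  continuous_from b h -> (forall y, b <= y -> h y = f y) -> is_kernel_limit a b 0 h l ->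
  is_oscillatory_integral a b f l.
Proof.
  intros Ha Hb Hc E O y0. destruct (O y0) as (J & HJ & L).
  eapply filterlim_ext_loc; [|exact L].
  exists (mkposreal 1 Rlt_0_1). intros eps _ He. symmetry.
  apply RInt_gen_improper with (h := fun y => (kernel a eps y0 0 y * h y)%C).
  - now apply continuous_from_kernel_mult.
  - intros y Hy. rewrite E by assumption. unfold kernel, phase. f_equal.
    change ((/ rate a eps y0 y) ^ 0)%C with (RtoC 1). ring.
  - now apply HJ.
Qed.

Lemma oscillatory_integral_eq (a b : R) (f : R -> C) (l : C) : is_oscillatory_integral a b f l ->
  oscillatory_integral a b f = l.
Proof.
  intros H. apply (iota_unique (V := C_R_CompleteNormedModule)); auto.
  intros m Hm. apply (filterlim_locally_unique (V := C_R_NormedModule) _ _ _ (Hm 0) (H 0)).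
Qed.

Lemma fold_right_Rplus_nonneg (s : list R) : (forall x, In x s -> 0 <= x) ->
    0 <= fold_right Rplus 0 s.
Proof.
  induction s as [|x s IH]; intros H; simpl; [lra|].
  apply Rplus_le_le_0_compat; [apply H; now left | apply IH; intros; apply H; now right].
Qed.

Lemma fold_right_Rplus_ge (s : list R) (x : R) : (forall y, In y s -> 0 <= y) -> In x s ->
    x <= fold_right Rplus 0 s.
Proof.
  induction s as [|y s IH]; intros H E; [destruct E|destruct E as [E|E]]; simpl.
  - subst y. assert (0 <= fold_right Rplus 0 s); [|lra]. apply fold_right_Rplus_nonneg.
    intros; apply H; now right.
  - assert (0 <= y) by (apply H; now left). assert (x <= fold_right Rplus 0 s); [|lra].
    apply IH; auto. intros; apply H; now right.
Qed.

(** Each summand of the norm is nonnegative, hence bounded by the norm.  The least upper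
    bound is finite by the growth condition, so taking its real part loses nothing. *)
Lemma Cn_alpha_norm_bounds (n : nat) (alpha b : R) (f : R -> C) : is_Cn_alpha n alpha b f ->
  (forall k, (k < n)%nat -> Cmod (Derive_n_from b f k b)
    <= Cn_alpha_norm n alpha b f * Rpower b (INR (n - k) + alpha)) /\
  (forall y, b <= y -> Cmod (Derive_n_from b f n y) <= Cn_alpha_norm n alpha b f * Rpower y alpha).
Proof.
  intros (_ & M & HM & HB). unfold Cn_alpha_norm.
  set (s := map _ _). set (E := fun r : R => _).
  assert (Hs : forall x, In x s -> 0 <= x).
  { intros x Hx. apply in_map_iff in Hx. destruct Hx as (k & <- & _).
    apply Rdiv_le_0_compat. apply Cmod_ge_0. apply Rpower_pos. }
  assert (HE : forall y, b <= y ->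
    Cmod (Derive_n_from b f n y) / Rpower y alpha <= real (Lub_Rbar E)).
  { intros y Hy. destruct (Lub_Rbar_correct E) as [Hub Hlub].
    assert (Hy1 : E (Cmod (Derive_n_from b f n y) / Rpower y alpha)) by (exists y; auto).
    specialize (Hub _ Hy1).
    assert (HbM : Rbar_le (Lub_Rbar E) M).
    { apply Hlub. intros r (t & Ht & ->). simpl. apply Rcomplements.Rle_div_l. apply Rpower_pos.
      now apply HB. }
    destruct (Lub_Rbar E); simpl in *; tauto. }
  assert (HE0 : 0 <= real (Lub_Rbar E)).
  { eapply Rle_trans; [|apply (HE b (Rle_refl b))]. apply Rdiv_le_0_compat. apply Cmod_ge_0.
    apply Rpower_pos. }
  pose proof (fold_right_Rplus_nonneg s Hs) as Hs0.
  split.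
  - intros k Hk. apply Rcomplements.Rle_div_l. apply Rpower_pos.
    apply Rle_trans with (fold_right Rplus 0 s); [|lra]. apply fold_right_Rplus_ge; auto.
    apply in_map_iff. exists k. split; auto. apply in_seq. lia.
  - intros y Hy. apply Rcomplements.Rle_div_l. apply Rpower_pos. specialize (HE y Hy). lra.
Qed.

(** Crude form of integrating [t^beta]: on [[b, y]] it is at most [y^beta], and the
    length of the interval is at most [y]. *)
Lemma growth_from_derive (b c beta : R) (g dg : R -> C) : 0 < b -> 0 <= beta ->
  (forall y, b <= y -> is_deriveC g y (dg y)) -> continuous_from b dg ->
  (forall y, b <= y -> Cmod (dg y) <= c * Rpower y beta) ->
  forall y, b <= y -> Cmod (g y) <= Cmod (g b) + c * Rpower y (beta + 1).
Proof.
  intros Hb Hbeta Hd Hc HB y Hy.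
  assert (Hc0 : 0 <= c).
  { exact (bound_constant_ge_0 _ _ _ _ (HB b (Rle_refl b))). }
  assert (HI : is_RInt (V := C_R_NormedModule) dg b y (g y - g b)%C).
  { apply (is_RInt_derive (V := C_R_CompleteNormedModule)); intros x Hx;
      rewrite Rmin_left, Rmax_right in Hx by assumption; [apply Hd | apply Hc]; lra. }
  assert (HN : Cmod (g y - g b) <= (y - b) * (c * Rpower y beta)).
  { rewrite <- norm_C_R. apply (norm_RInt_le_const (V := C_R_NormedModule) dg b y); auto.
    intros x Hx. rewrite norm_C_R. eapply Rle_trans; [apply HB; lra|].
    apply Rmult_le_compat_l; auto. apply Rle_Rpower_l; lra. }
  replace (g y) with (g b + (g y - g b))%C by ring.
  eapply Rle_trans; [apply Cmod_triangle|]. apply Rplus_le_compat_l. eapply Rle_trans; [exact HN|].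
  rewrite Rpower_plus, Rpower_1 by lra. pose proof (Rpower_pos y beta).
  assert (0 <= c * Rpower y beta) by (apply Rmult_le_pos; lra). nra.
Qed.

(** Going down from the [n]-th derivative, each integration raises the exponent by one
    and adds one summand of the norm to the constant. *)
Lemma Cn_alpha_jet (n : nat) (alpha b : R) (f : R -> C) : 0 < b -> 0 <= alpha ->
    is_Cn_alpha n alpha b f ->
  exists H : nat -> R -> C, (forall y, b <= y -> H 0%nat y = f y) /\
    jet b n (alpha + INR n) ((INR n + 1) * Cn_alpha_norm n alpha b f) H.
Proof.
  intros Hb Ha Hf. destruct (Cn_alpha_norm_bounds n alpha b f Hf) as [B1 B2].
  set (v := Cn_alpha_norm n alpha b f) in *.
  destruct Hf as [HCn _].
  destruct (jet_extension n b (Derive_n_from b f)) as (H & HE & HD & HC).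
  { apply Derive_n_from_derive; auto. } { apply HCn. }
  assert (Hv : 0 <= v).
  { exact (bound_constant_ge_0 _ _ _ _ (B2 b (Rle_refl b))). }
  exists H. split. { intros y Hy. rewrite HE by (auto; lia). reflexivity. }
  assert (HCk : forall k, (k <= n)%nat -> continuous_from b (H k)).
  { intros k Hk y Hy. destruct (Nat.eq_dec k n) as [->|Hne]; [apply HC|].
    eapply is_derive_continuous_C. apply HD. lia. }
  (* [j] counts downwards from the top derivative *)
  assert (HB : forall j, (j <= n)%nat -> forall y, b <= y ->
    Cmod (H (n - j)%nat y) <= ((INR j + 1) * v) * Rpower y (alpha + INR j)).
  { induction j as [|j IH]; intros Hj y Hy.
    - rewrite Nat.sub_0_r. simpl INR. rewrite Rplus_0_r, Rplus_0_l, Rmult_1_l. rewrite HE by auto.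
      now apply B2.
    - assert (Hg := growth_from_derive b ((INR j + 1) * v) (alpha + INR j) (H (n
      - S j)%nat) (H (n - j)%nat) Hb).
      specialize (Hg ltac:(pose proof (pos_INR j); lra)).
      assert (Hk : (n - j = S (n - S j))%nat) by lia.
      specialize (Hg ltac:(intros; rewrite Hk; apply HD; lia) ltac:(apply HCk;
        lia) (IH ltac:(lia)) y Hy).
      eapply Rle_trans; [exact Hg|]. rewrite HE by (auto; lra || lia).
      rewrite S_INR. replace (alpha + (INR j + 1)) with (alpha + INR j + 1) by ring.
      assert (Hb1 := B1 (n - S j)%nat ltac:(lia)).
      replace (n - (n - S j))%nat with (S j) in Hb1 by lia. rewrite S_INR in Hb1.
      replace (INR j + 1 + alpha) with (alpha + INR j + 1) in Hb1 by ring.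
      assert (Rpower b (alpha + INR j + 1) <= Rpower y (alpha + INR j + 1)).
      { apply Rle_Rpower_l; [pose proof (pos_INR j)|]; lra. }
      assert (v * Rpower b (alpha + INR j + 1) <= v * Rpower y (alpha + INR j + 1))
        by (apply Rmult_le_compat_l; auto).
      lra. }
  split; [|split].
  - intros k y Hk _. now apply HD.
  - apply HCk. lia.
  - intros k y Hk Hy. specialize (HB (n - k)%nat ltac:(lia) y Hy).
    replace (n - (n - k))%nat with k in HB by lia. rewrite minus_INR in HB by assumption.
    replace (alpha + INR n - INR k) with (alpha + (INR n - INR k)) by ring.
    eapply Rle_trans; [exact HB|]. apply Rmult_le_compat_r. apply Rlt_le, Rpower_pos.
    apply Rmult_le_compat_r; auto. pose proof (pos_INR k). lra.
Qed.

(** The continuation [h] of [f] is kept in the conclusion because linearity of the limit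
    in the integrand is proved for continuous integrands. *)
Lemma oscillatory_integral_bound (a b alpha : R) (n : nat) : a <> 0 -> 0 < b -> 0 <= alpha ->
    alpha + 1 < INR n ->
  exists A, forall f, is_Cn_alpha n alpha b f ->
    exists (h : R -> C) (l : C), continuous_from b h /\ (forall y, b <= y -> h y = f y) /\
      is_kernel_limit a b 0 h l /\ Cmod l <= A * Cn_alpha_norm n alpha b f.
Proof.
  intros Ha Hb Hal Hn.
  destruct (kernel_limit_jet a b Ha Hb n 0 (alpha + INR n)) as [A HA]. { simpl INR. lra. }
  exists (A * (INR n + 1)). intros f Hf.
  destruct (Cn_alpha_jet n alpha b f Hb Hal Hf) as (H & HE & HJ).
  destruct (HA _ _ HJ) as (l & Hl & O).
  exists (H 0%nat), l. split; [|split; [|split]]; auto.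
  - eapply jet_continuous; eauto. lia.
  - rewrite Rmult_assoc. exact Hl.
Qed.

Theorem proposition3p6
    (a b alpha : R) (n : nat) (f : R -> C) (fs : nat -> R -> C)
    (ha : a <> 0) (hb : 0 < b) (halpha : 0 <= alpha)
    (hn : alpha + 1 < INR n)
    (hf : is_Cn_alpha n alpha b f)
    (hfs : forall m : nat, is_Cn_alpha n alpha b (fs m))
    (hlim : is_lim_seq
              (fun m : nat =>
                 Cn_alpha_norm n alpha b (fun y : R => (f y - fs m y)%C)) 0) :
  filterlim (fun m : nat => oscillatory_integral a b (fs m)) eventually
    (locally (oscillatory_integral a b f)).
Proof.
  destruct (oscillatory_integral_bound a b alpha n ha hb halpha hn) as [A HA].
  assert (key : forall m, Cmod (oscillatory_integral a b (fs m) - oscillatory_integral a b f)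
    <= A * Cn_alpha_norm n alpha b (fun y : R => (f y - fs m y)%C)).
  { intros m.
    destruct (HA f hf) as (h & l & Hc & HE & HO & _).
    destruct (HA (fs m) (hfs m)) as (hm & lm & Hcm & HEm & HOm & _).
    destruct (HA _ (is_Cn_alpha_minus n alpha b f (fs m) hf (hfs m)))
      as (hd & ld & Hcd & HEd & HOd & Hld).
    rewrite (oscillatory_integral_eq a b f l)
      by (apply (kernel_limit_is_oscillatory_integral a b h); auto).
    rewrite (oscillatory_integral_eq a b (fs m) lm)
      by (apply (kernel_limit_is_oscillatory_integral a b hm); auto).
    assert (E : ld = (l - lm)%C).
    { apply (kernel_limit_unique a b 0 hd); auto.
      apply (kernel_limit_ext a b 0 (fun y => h y - hm y)%C).
      - intros y Hy. now rewrite HE, HEm, HEd.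
      - apply kernel_limit_minus; auto. }
    replace (lm - l)%C with (- ld)%C by (rewrite E; ring). now rewrite Cmod_opp. }
  apply filterlim_C. apply eventually_filter. intros eps Heps.
  apply (is_lim_seq_scal_l _ A) in hlim. simpl in hlim. rewrite Rmult_0_r in hlim.
  apply is_lim_seq_spec in hlim. destruct (hlim (mkposreal eps Heps)) as [N HN].
  exists N. intros m Hm. specialize (HN m Hm). simpl in HN. rewrite Rminus_0_r in HN.
  eapply Rle_lt_trans; [apply key|]. eapply Rle_lt_trans; [apply Rle_abs|]. exact HN.
Qed.
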